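(* Let $\alpha\in(1,2)$ and let $\mu:[0,1]^2\to\mathbb{C}$ be an essentially bounded complex-valued function. With $\hat B_{\mathbf n}=T_{\mathbf n}(t_\alpha)$, $\mathbf n=(n,n)$, $h=\frac1{n+1}$, the following hold: (a1) $\{\hat B_{\mathbf n}+h^\alpha D_{\mathbf n}(\mu)\}_n\sim_{\rm GLT} t_\alpha$; (a2) $\{\hat B_{\mathbf n}+h^\alpha D_{\mathbf n}(\mu)\}_n\sim_\sigma t_\alpha$; (a3) $\{\hat B_{\mathbf n}+h^\alpha D_{\mathbf n}(\mu)\}_n\sim_\lambda t_\alpha$.
   Context: **Matrices.** For $n\in\mathbb N$ put $\mathbf n=(n,n)$ and $h=h(n)=\frac{1}{n+1}$; all matrix sequences below are indexed by $n\to\infty$ and consist of matrices of size $d_n=n^2$. Rows and columns are indexed by pairs $\mathbf i=(i_1,i_2)$, $1\le i_1,i_2\le n$, in lexicographic order. For $f\in L^1([-\pi,\pi]^2)$, $T_{\mathbf n}(f)=[\hat f_{\mathbf i-\mathbf j}]_{\mathbf i,\mathbf j}$ with $\hat f_{\mathbf k}=\frac1{(2\pi)^2}\int_{[-\pi,\pi]^2}f(\theta_1,\theta_2)e^{-\mathrm i(k_1\theta_1+k_2\theta_2)}\,d\theta_1d\theta_2$. The function $t_\alpha$ is $t_\alpha(\theta_1,\theta_2)=\left[4\sin^2(\theta_1/2)+4\sin^2(\theta_2/2)\right]^{\alpha/2}$. $D_{\mathbf n}(\mu)$ is the $n^2\times n^2$ diagonal matrix with diagonal entries $\mu(ih,jh)$,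 $1\le i,j\le n$, in lexicographic order. $\|\cdot\|$ is the spectral norm. **Distributions.** Let $\psi:D\subset\mathbb R^t\to\mathbb C$ be measurable with $0<|D|<\infty$. $\{A_n\}_n\sim_\sigma\psi$ means $\lim_{n\to\infty}\frac1{d_n}\sum_{i=1}^{d_n}F(\sigma_i(A_n))=\frac1{|D|}\int_D F(|\psi(x)|)\,dx$ for every continuous compactly supported $F:\mathbb R\to\mathbb C$, where $\sigma_i$ denotes singular values. $\{A_n\}_n\sim_\lambda\psi$ means $\lim_{n\to\infty}\frac1{d_n}\sum_{i=1}^{d_n}F(\lambda_i(A_n))=\frac1{|D|}\int_D F(\psi(x))\,dx$ for every continuous compactly supported $F:\mathbb C\to\mathbb C$, where $\lambda_i$ denotes eigenvalues. For $t_\alpha$ take $D=[-\pi,\pi]^2$. **GLT sequences (2-level, scalar).** A class $\{\{B_{n,m}\}_n\}_m$ is an approximating class of sequences (a.c.s.) for $\{A_n\}_n$ if for every $m$ there is $n_m$ such that for all $n\ge n_m$ one has $A_n=B_{n,m}+R_{n,m}+N_{n,m}$ with $\mathrm{rank}\,R_{n,m}\le c(m)d_n$ and $\|N_{n,m}\|\le\omega(m)$, where $n_m$, $c(m)$, $\omega(m)$ depend only on $m$ and $c(m),\omega(m)\to0$ as $m\to\infty$. For a measurable $\kappa:[0,1]^2\times[-\pi,\pi]^2\to\mathbb C$, $\{A_n\}_n\sim_{\rm GLT}\kappa$ (generalized locally Toeplitz sequence with symbol $\kappa$) means: for each $m\in\mathbb N$ there are finitely many functions $a_{i,m}\in C^\infty([0,1]^2)$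 and trigonometric polynomials $f_{i,m}$ in two variables, $i=1,\dots,N_m$, such that $\sum_i a_{i,m}(\mathbf x)f_{i,m}(\boldsymbol\theta)\to\kappa(\mathbf x,\boldsymbol\theta)$ in measure as $m\to\infty$ and $\{\{\sum_{i}\mathrm{diag}_{\mathbf j}\big(a_{i,m}(\mathbf j/n)\big)\,T_{\mathbf n}(f_{i,m})\}_n\}_m$ is an a.c.s. for $\{A_n\}_n$. A function of $\boldsymbol\theta$ only, such as $t_\alpha$, is regarded as a function of $(\mathbf x,\boldsymbol\theta)$.
   Formalization: Besides essential boundedness, μ is assumed bounded on the sampled grid points (ih, jh), uniformly in n; an almost-everywhere bound alone does not control D_n(μ), and the claim fails without it. Every μ bounded on [0,1]^2 qualifies. *)

(* Defs.v *)
(* Complex numbers are [R[i]] over [R : realType]; [R[i]^o] is the same type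
   equipped with the topology of the modulus. *)
From HB Require Import structures.
From mathcomp Require Import all_boot all_order all_algebra.
From mathcomp Require Import all_classical all_reals all_analysis.
From mathcomp Require Import complex.

Set Implicit Arguments.
Unset Strict Implicit.
Unset Printing Implicit Defensive.

Import Order.TTheory GRing.Theory Num.Theory.
Import numFieldNormedType.Exports.

Local Open Scope classical_set_scope.
Local Open Scope ring_scope.
Local Open Scope complex_scope.
Local Open Scope sesquilinear_scope.

Section complex_valued.
Context {R : realType}.

(* The norm of [R[i]] is itself [R[i]]-valued. *)
Definition modC (z : R[i]) : R := complex.Re `|z|.

Definition expi (t : R) : R[i] := cos t +i* sin t.

Definition cmeasurable_fun {d} {T : measurableType d} (D : set T)
    (f : T -> R[i]) : Prop :=
  measurable_fun D (fun x => complex.Re (f x)) /\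
  measurable_fun D (fun x => complex.Im (f x)).

Definition cintegral {d} {T : measurableType d}
    (nu : {measure set T -> \bar R}) (D : set T) (f : T -> R[i]) : R[i] :=
  (\int[nu]_(x in D) complex.Re (f x)) +i* (\int[nu]_(x in D) complex.Im (f x)).

Definition compactly_supported {T : topologicalType} (F : T -> R[i]) : Prop :=
  compact (closure [set x | F x != 0]).

(* [lebesgue_measure] lives on [measurableTypeR R], an alias of [R]. *)
Local Notation plane := (measurableTypeR R * measurableTypeR R)%type.

Definition leb2 : set plane -> \bar R :=
  (lebesgue_measure \x lebesgue_measure)%E.

HB.instance Definition _ := Measure.on leb2.

Lemma sigma_finite_leb2 : sigma_finite setT leb2.
Proof.
have /sigma_finiteP[F [TF ndF Foo]] :=
  sigma_finiteT (@lebesgue_measure R).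
exists (fun n => F n `*` F n).
  rewrite -setXTT TF predeqE => -[x y]; split.
    move=> [/= [n _ Fnx] [k _ Fky]]; exists (maxn n k) => //; split.
    - by move: x Fnx; exact/subsetPset/ndF/leq_maxl.
    - by move: y Fky; exact/subsetPset/ndF/leq_maxr.
  by move=> [n _ []/= ? ?]; split; exists n.
move=> k; have [? ?] := Foo k.
split; first exact: measurableX.
by rewrite /leb2 product_measure1E// lte_mul_pinfty// ge0_fin_numE.
Qed.

HB.instance Definition _ := @Measure_isSigmaFinite.Build _ _ _ leb2
  sigma_finite_leb2.

Definition leb4 : set (plane * plane) -> \bar R := (leb2 \x leb2)%E.

HB.instance Definition _ := Measure.on leb4.

Definition unit_square : set plane := `[0, 1] `*` `[0, 1].

Definition torus_square : set plane := `[- pi, pi] `*` `[- pi, pi].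

End complex_valued.

Section matrices.
Context {R : realType}.

(* With multiplicity: the roots of the characteristic polynomial. *)
Definition eigenvalues {n : nat} (A : 'M[R[i]]_n) : seq R[i] :=
  sval (closed_field_poly_normal (char_poly A)).

Definition singular_values {n : nat} (A : 'M[R[i]]_n) : seq R :=
  [seq Num.sqrt (complex.Re z) | z <- eigenvalues (A ^t* *m A)].

Definition spectral_norm {n : nat} (A : 'M[R[i]]_n) : R :=
  \big[Num.max/0]_(s <- singular_values A) s.

(* The (0-based) position [k] in the lexicographic enumeration of the pairs
   [(i1, i2)], [1 <= i1, i2 <= n], corresponds to
   [i1 = (k %/ n).+1] and [i2 = (k %% n).+1]. *)
Definition lex1 {n : nat} (k : 'I_(n * n)) : nat := (k %/ n).+1.
Definition lex2 {n : nat} (k : 'I_(n * n)) : nat := (k %% n).+1.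

Definition fourier_coef (f : R * R -> R[i]) (k1 k2 : int) : R[i] :=
  (((2 * pi) ^+ 2)^-1)%:C *
  cintegral leb2 torus_square
    (fun th => f th * expi (- (k1%:~R * th.1 + k2%:~R * th.2))).

Definition toeplitz (n : nat) (f : R * R -> R[i]) : 'M[R[i]]_(n * n) :=
  \matrix_(k, l) fourier_coef f ((lex1 k)%:Z - (lex1 l)%:Z)
                                ((lex2 k)%:Z - (lex2 l)%:Z).

Definition sampling_mx (n : nat) (s : R) (a : R * R -> R[i]) :
    'M[R[i]]_(n * n) :=
  diag_mx (\row_k a ((lex1 k)%:R * s, (lex2 k)%:R * s)).

Definition step (n : nat) : R := n.+1%:R^-1.

Definition D_mx (n : nat) (mu : R * R -> R[i]) : 'M[R[i]]_(n * n) :=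
  sampling_mx n (step n) mu.

Definition t_alpha (alpha : R) (th : R * R) : R[i] :=
  ((4 * sin (th.1 / 2) ^+ 2 + 4 * sin (th.2 / 2) ^+ 2) `^ (alpha / 2))%:C.

End matrices.

Section distributions.
Context {R : realType}.

Definition sing_distr {d} {T : measurableType d}
    (nu : {measure set T -> \bar R}) (D : set T)
    (A : forall n : nat, 'M[R[i]]_(n * n)) (psi : T -> R[i]) : Prop :=
  [/\ measurable D, (0 < nu D < +oo)%E, cmeasurable_fun D psi &
    forall F : R -> R[i]^o, continuous F -> compactly_supported F ->
      (((n * n)%:R^-1 * \sum_(s <- singular_values (A n)) F s : R[i]^o)
         @[n --> \oo] -->
       (((fine (nu D))^-1)%:C * cintegral nu D (fun x => F (modC (psi x)))
         : R[i]^o))].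

Definition eig_distr {d} {T : measurableType d}
    (nu : {measure set T -> \bar R}) (D : set T)
    (A : forall n : nat, 'M[R[i]]_(n * n)) (psi : T -> R[i]) : Prop :=
  [/\ measurable D, (0 < nu D < +oo)%E, cmeasurable_fun D psi &
    forall F : R[i]^o -> R[i]^o, continuous F -> compactly_supported F ->
      (((n * n)%:R^-1 * \sum_(z <- eigenvalues (A n)) F z : R[i]^o)
         @[n --> \oo] -->
       (((fine (nu D))^-1)%:C * cintegral nu D (fun x => F (psi x))
         : R[i]^o))].

End distributions.

Section glt.
Context {R : realType}.

Definition acs (B : nat -> forall n : nat, 'M[R[i]]_(n * n))
    (A : forall n : nat, 'M[R[i]]_(n * n)) : Prop :=
  exists c omega : nat -> R,
    [/\ c m @[m --> \oo] --> (0 : R),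
        omega m @[m --> \oo] --> (0 : R) &
        forall m : nat, exists nm : nat, forall n : nat, (nm <= n)%N ->
          exists Rnm Nnm : 'M[R[i]]_(n * n),
            [/\ A n = B m n + Rnm + Nnm,
                (\rank Rnm)%:R <= c m * (n * n)%:R &
                spectral_norm Nnm <= omega m]].

Fixpoint Ck (k : nat) (g : R * R -> R) : Prop :=
  continuous g /\
  if k is k'.+1 then
    [/\ forall x, derivable g x (1, 0), forall x, derivable g x (0, 1),
        Ck k' (fun x => 'D_(1, 0) g x) & Ck k' (fun x => 'D_(0, 1) g x)]
  else True.

(* Restrictions to [0,1]^2 of infinitely differentiable functions on R^2. *)
Definition smooth_on_unit_square (a : R * R -> R[i]) : Prop :=
  exists u v : R * R -> R,
    [/\ forall k, Ck k u, forall k, Ck k v &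
        forall x, unit_square x -> a x = u x +i* v x].

Definition trig_polynomial (f : R * R -> R[i]) : Prop :=
  exists s : seq (R[i] * (int * int)), forall th : R * R,
    f th = \sum_(p <- s) p.1 * expi (p.2.1%:~R * th.1 + p.2.2%:~R * th.2).

Definition cvg_in_measure {d} {T : measurableType d}
    (nu : {measure set T -> \bar R}) (D : set T)
    (g : nat -> T -> R[i]) (k : T -> R[i]) : Prop :=
  forall eps : R, 0 < eps ->
    nu (D `&` [set x | eps < modC (g m x - k x)]) @[m --> \oo] --> 0%E.

(* The first component of the argument of the symbol is the spatial variable,
   the second one the Fourier variable. *)
Definition GLT (A : forall n : nat, 'M[R[i]]_(n * n))
    (kappa : (R * R) * (R * R) -> R[i]) : Prop :=
  cmeasurable_fun (unit_square `*` torus_square) kappa /\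
  exists (N : nat -> nat) (a f : nat -> nat -> R * R -> R[i]),
    [/\ forall m i, (i < N m)%N -> smooth_on_unit_square (a m i),
        forall m i, (i < N m)%N -> trig_polynomial (f m i),
        cvg_in_measure leb4 (unit_square `*` torus_square)
          (fun m p => \sum_(i < N m) a m i p.1 * f m i p.2) kappa &
        acs (fun m n => \sum_(i < N m)
               sampling_mx n n%:R^-1 (a m i) *m toeplitz n (f m i)) A].

End glt.

Section sampling.
Context {R : realType}.

Definition ess_bounded (mu : R * R -> R[i]) : Prop :=
  exists M : R, \forall x \ae (@leb2 R), unit_square x -> modC (mu x) <= M.

(* The matrices [D_mx n mu] read [mu] on a null set of grid points, so an
   essential bound says nothing about them: this is the requirement that the
   chosen representative of [mu] be bounded at the sampled points.  It holds
   for every [mu] that is bounded on [0,1]^2. *)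
Definition bounded_samples (mu : R * R -> R[i]) : Prop :=
  exists M : R, forall n i j : nat, (1 <= i <= n)%N -> (1 <= j <= n)%N ->
    modC (mu (i%:R * step n, j%:R * step n)) <= M.

Definition perturbed (alpha : R) (mu : R * R -> R[i]) (n : nat) :
    'M[R[i]]_(n * n) :=
  toeplitz n (t_alpha alpha) + (step n `^ alpha)%:C *: D_mx n mu.

End sampling.

(* Main.v *)
Require Import Defs.
From mathcomp Require Import all_boot all_order all_algebra ring lra zify.
From mathcomp Require Import all_classical all_reals all_analysis.
From mathcomp Require Import measurable_realfun complex.

Set Implicit Arguments.
Unset Strict Implicit.
Unset Printing Implicit Defensive.

Import Order.TTheory GRing.Theory Num.Theory.
Import numFieldNormedType.Exports.
Import Defs.

(** Write [A_n] for the perturbed matrices, [T_n(f)] for Toeplitz matrices,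
    [t] for the symbol [t_alpha] and [N = n^2] for the size.

    The symbol is a continuous function, [s |-> s^(alpha/2)], of the
    trigonometric polynomial [s = 4 - 2 cos th1 - 2 cos th2], whose values lie
    in [0,8]. By Weierstrass' theorem ([weierstrass]) it is therefore a
    uniform limit of real trigonometric polynomials ([approximable_t_alpha]).
    The diagonal term has norm at most [h^alpha M <= h M], which tends to zero
    ([opb_potential_small]). Since [T_n(f)] is the compression to
    trigonometric polynomials of the multiplication by [f], a real bound [|f|
    <= G] gives the operator bound [G] ([opb_toeplitz]). These three facts
    already yield the GLT property, with one term [1 * p_m], no low-rank
    correction, and [p_m] a trigonometric polynomial close to [t].

    For the two distributions, the central fact is that [T_n(f) T_n(g)] and
    [T_n(f g)] differ by a matrix whose Frobenius norm is [o(n)]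
    ([toeplitzM_negl]). For exponentials, [T_n] is a truncated shift, and the
    difference has at most one unit entry in each of the [O(n)] columns that
    the shift pushes out of the box ([fro_shift_mul]); bilinearity and uniform
    approximation extend this to all [f] and [g] in the uniform closure of the
    trigonometric polynomials. Hence the relation [asymp X f], which says that
    [X_n] is uniformly bounded and [X_n - T_n(f)] is [o(n)] in Frobenius norm,
    is compatible with products. It holds for [A_n] and [A_n^*] with symbol
    [t], so it holds for [A_n^k] with [t^k] and for [(A_n^* A_n)^k] with
    [t^(2k)]. As a trace is at most [n] times the Frobenius norm, and [\tr
    T_n(f)] is [N] times the mean of [f], all moments converge: [\tr (A_n^k)
    / N] tends to the mean of [t^k] ([asymp_trace]).

    Moments determine the distribution ([eigenvalues_cvg]). The eigenvalues
    stay in a fixed disc, and their imaginary parts tend to zero uniformly,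
    because eigenvalues lie in the numerical range and the skew part of [A_n]
    is that of the small diagonal term. In a thin strip around a real segment
    every continuous test function is uniformly close to a polynomial [p]
    ([strip_approx]), and [\sum_z p(z)] over the spectrum is a combination of
    the traces of powers ([trace_pow], from Schur's triangularization).
    Singular values follow from the same statement applied to [A_n^* A_n],
    with symbol [t^2] and test function [z |-> F (sqrt (Re z))].

    All matrix norms are handled through positive semidefiniteness
    certificates, and all matrix estimates up to constant factors: [|A + B|^2
    <= 2 (|A|^2 + |B|^2)] replaces the triangle inequality. *)

Local Open Scope ring_scope.
Local Open Scope sesquilinear_scope.

(** * Positive semidefinite matrices and norm bounds *)

Section psd.
Variable C : numClosedFieldType.
Implicit Types (a b c e : C) (n : nat).

Lemma adjmxM m n p (A : 'M[C]_(m, n)) (B : 'M[C]_(n, p)) :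
  (A *m B)^t* = B^t* *m A^t*.
Proof. by rewrite trmx_mul map_mxM. Qed.

Lemma adjmxD m n (A B : 'M[C]_(m, n)) : (A + B)^t* = A^t* + B^t*.
Proof. by rewrite linearD map_mxD. Qed.

Lemma adjmxN m n (A : 'M[C]_(m, n)) : (- A)^t* = - A^t*.
Proof. by rewrite linearN map_mxN. Qed.

Lemma adjmxZ m n c (A : 'M[C]_(m, n)) : (c *: A)^t* = c^* *: A^t*.
Proof. by rewrite linearZ map_mxZ. Qed.

Lemma adj_scalar_mx n c : (c%:M : 'M[C]_n)^t* = (c^*)%:M.
Proof. by rewrite tr_scalar_mx map_scalar_mx. Qed.

Lemma adj_diag_mx n (d : 'rV[C]_n) :
  (diag_mx d)^t* = diag_mx (map_mx Num.conj d).
Proof. by rewrite tr_diag_mx map_diag_mx. Qed.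

Lemma row_sqnorm_ge0 n (v : 'rV[C]_n) : 0 <= (v *m v^t*) 0 0.
Proof.
rewrite mxE; apply: sumr_ge0 => i _.
by rewrite !mxE -normCK exprn_ge0.
Qed.

Lemma row_sqnorm_gt0 n (v : 'rV[C]_n) : v != 0 -> 0 < (v *m v^t*) 0 0.
Proof.
move=> v0; rewrite lt_def row_sqnorm_ge0 andbT; apply: contra v0.
rewrite mxE psumr_eq0 => [|i _]; last by rewrite !mxE -normCK exprn_ge0.
move=> /allP v0; apply/eqP/rowP => i; rewrite !mxE; apply/eqP.
have := v0 i (mem_index_enum _).
by rewrite /= !mxE -normCK expf_eq0 normr_eq0.
Qed.

Definition psd n (P : 'M[C]_n) : Prop :=
  forall v : 'rV[C]_n, 0 <= (v *m P *m v^t*) 0 0.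

Lemma psdD n (P Q : 'M[C]_n) : psd P -> psd Q -> psd (P + Q).
Proof. by move=> hP hQ v; rewrite mulmxDr mulmxDl mxE addr_ge0. Qed.

Lemma psdZ n a (P : 'M[C]_n) : 0 <= a -> psd P -> psd (a *: P).
Proof. by move=> a0 hP v; rewrite -scalemxAr -scalemxAl mxE mulr_ge0. Qed.

Lemma psd_conj m n (P : 'M[C]_n) (B : 'M[C]_(m, n)) :
  psd P -> psd (B *m P *m B^t*).
Proof. by move=> hP v; have := hP (v *m B); rewrite adjmxM !mulmxA. Qed.

Lemma psd_gram m n (A : 'M[C]_(m, n)) : psd (A *m A^t*).
Proof.
by move=> v; have := row_sqnorm_ge0 (v *m A); rewrite adjmxM !mulmxA.
Qed.

Lemma psd_diag n (d : 'rV[C]_n) : (forall i, 0 <= d 0 i) -> psd (diag_mx d).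
Proof.
move=> d0 v; rewrite mxE; apply: sumr_ge0 => i _.
rewrite mul_mx_diag !mxE mulrAC -normCK.
by rewrite mulr_ge0// exprn_ge0.
Qed.

Lemma psd_scalar n a : 0 <= a -> psd (a%:M : 'M[C]_n).
Proof.
by move=> a0; rewrite -diag_const_mx; apply: psd_diag => i; rewrite mxE.
Qed.

Lemma psd_trace n (P : 'M[C]_n) : psd P -> 0 <= \tr P.
Proof.
move=> hP; apply: sumr_ge0 => i _; have := hP (delta_mx 0 i).
by rewrite -rowE -(mul1mx (row i P)) !mxE; rewrite (bigD1 i)//= big1 ?addr0;
   [rewrite !mxE !eqxx conjC1 mulr1 big_ord1 !mxE eqxx mul1r
   |move=> j ji; rewrite !mxE (negPf ji) conjC0 mulr0].
Qed.

(** [c] bounds the square of the operator norm: keeping the square and asking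
    for a positivity certificate turns every norm estimate below into an
    algebraic identity between positive semidefinite matrices. *)
Definition opb n (A : 'M[C]_n) c : Prop := psd (c%:M - A *m A^t*).

Lemma opb_le n (A : 'M[C]_n) a b : a <= b -> opb A a -> opb A b.
Proof.
move=> ab hA; rewrite /opb -(subrK a b) raddfD/= -addrA.
by apply: psdD => //; apply: psd_scalar; rewrite subr_ge0.
Qed.

(** The difference of the two sides is
    [2 (a - A A') + 2 (b - B B') + (A - B) (A - B)'], a prime being an adjoint. *)
Lemma opbD n (A B : 'M[C]_n) a b :
  opb A a -> opb B b -> opb (A + B) (2 * (a + b)).
Proof.
move=> hA hB; rewrite /opb.
have -> : (2 * (a + b))%:M - (A + B) *m (A + B)^t* =
  2 *: (a%:M - A *m A^t*) + 2 *: (b%:M - B *m B^t*)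
  + (A - B) *m (A - B)^t*.
  rewrite !(adjmxD, adjmxN) !(mulmxDl, mulmxDr, mulmxN, mulNmx) opprK.
  move: (A *m A^t*) (A *m B^t*) (B *m A^t*) (B *m B^t*) => x y z w.
  by apply/matrixP => i j; rewrite !mxE; ring.
apply: psdD (psd_gram _); apply: psdD; exact: psdZ.
Qed.

Lemma opbN n (A : 'M[C]_n) a : opb A a -> opb (- A) a.
Proof. by rewrite /opb adjmxN mulNmx mulmxN opprK. Qed.

Lemma opbM n (A B : 'M[C]_n) a b :
  0 <= b -> opb A a -> opb B b -> opb (A *m B) (a * b).
Proof.
move=> b0 hA hB; rewrite /opb.
have -> : (a * b)%:M - A *m B *m (A *m B)^t* =
    A *m (b%:M - B *m B^t*) *m A^t* + b *: (a%:M - A *m A^t*).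
  rewrite adjmxM mulmxBr mulmxBl !mulmxA mul_mx_scalar -scalemxAl scalerBr.
  by rewrite scale_scalar_mx mulrC [RHS]addrC addrA subrK.
by apply: psdD; [exact: psd_conj|exact: psdZ].
Qed.

Lemma opb_scalar n c : opb (c%:M : 'M[C]_n) (`|c| ^+ 2).
Proof.
rewrite /opb adj_scalar_mx -scalar_mxM normCK subrr => v.
by rewrite mulmx0 mul0mx mxE.
Qed.

Lemma opb_diag n (d : 'rV[C]_n) b :
  (forall i, `|d 0 i| ^+ 2 <= b) -> opb (diag_mx d) b.
Proof.
move=> hd; rewrite /opb adj_diag_mx mulmx_diag -diag_const_mx -raddfB.
by apply: psd_diag => i; rewrite !mxE subr_ge0 -normCK.
Qed.

(** With [P = G - A] and [Q = G + A], both positive semidefinite, one has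
    [2 G (G^2 - A^2) = P Q P + Q P Q]. *)
Lemma opb_herm n (A : 'M[C]_n) G : 0 < G -> A^t* = A ->
  psd (G%:M - A) -> psd (G%:M + A) -> opb A (G ^+ 2).
Proof.
move=> G0 hA hP hQ; rewrite /opb hA.
have GR : G^* = G by apply/CrealP/gtr0_real.
have -> : (G ^+ 2)%:M - A *m A = (2 * G)^-1 *:
   ((G%:M - A) *m (G%:M + A) *m (G%:M - A)^t* +
    (G%:M + A) *m (G%:M - A) *m (G%:M + A)^t*).
  rewrite adjmxD adjmxN adjmxD hA adj_scalar_mx GR.
  rewrite !(mulmxDl, mulmxDr, mulmxN, mulNmx).
  rewrite !(mul_mx_scalar, mul_scalar_mx) -?scalemxAr -?scalemxAl.
  rewrite ?scale_scalar_mx ?mul_scalar_mx.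
  move: (A *m A *m A) (A *m A) => x y.
  apply/matrixP => i j; rewrite !mxE.
  by case: (i == j); rewrite ?mulr1n ?mulr0n; field; rewrite (gt_eqF G0).
apply: psdZ; first by rewrite invr_ge0 mulr_ge0// ltW.
by apply: psdD; apply: psd_conj.
Qed.

(** The square of the Frobenius norm. *)
Definition fro n (A : 'M[C]_n) : C := \tr (A *m A^t*).

Lemma fro_ge0 n (A : 'M[C]_n) : 0 <= fro A.
Proof. exact/psd_trace/psd_gram. Qed.

Lemma froE n (A : 'M[C]_n) : fro A = \sum_i \sum_j `|A i j| ^+ 2.
Proof.
apply: eq_bigr => i _; rewrite mxE; apply: eq_bigr => j _.
by rewrite !mxE normCK.
Qed.

Lemma fro_adj n (A : 'M[C]_n) : fro (A^t*) = fro A.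
Proof. by rewrite /fro trmxCK mxtrace_mulC. Qed.

Lemma froZ n c (A : 'M[C]_n) : fro (c *: A) = `|c| ^+ 2 * fro A.
Proof.
by rewrite /fro adjmxZ -scalemxAl -scalemxAr scalerA -normCK mxtraceZ.
Qed.

Lemma froD n (A B : 'M[C]_n) : fro (A + B) <= 2 * (fro A + fro B).
Proof.
rewrite -subr_ge0.
have -> : 2 * (fro A + fro B) - fro (A + B) = fro (A - B).
  rewrite /fro !(adjmxD, adjmxN) !(mulmxDl, mulmxDr, mulmxN, mulNmx) opprK.
  by rewrite !(raddfD, raddfN) /=; ring.
exact: fro_ge0.
Qed.

Lemma fro_opb n (A : 'M[C]_n) a : opb A a -> fro A <= a * n%:R.
Proof.
by move=> /psd_trace; rewrite raddfB/= mxtrace_scalar subr_ge0 mulr_natr.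
Qed.

Lemma froMr n (A B : 'M[C]_n) b : opb B b -> fro (A *m B) <= b * fro A.
Proof.
move=> hB; rewrite -subr_ge0 /fro adjmxM -mxtraceZ -raddfB/=.
have -> : b *: (A *m A^t*) - A *m B *m (B^t* *m A^t*) =
    A *m (b%:M - B *m B^t*) *m A^t*.
  by rewrite mulmxBr mulmxBl !mulmxA mul_mx_scalar -scalemxAl.
exact/psd_trace/psd_conj.
Qed.

Lemma froMl n (A B : 'M[C]_n) a : opb (A^t*) a -> fro (A *m B) <= a * fro B.
Proof. by move=> hA; rewrite -fro_adj adjmxM -[fro B]fro_adj froMr. Qed.

(** Cauchy-Schwarz for the Frobenius pairing with the identity, read off from
    the trace of [(A - x) (A - x)^*] at [x = \tr A / n]. *)
Lemma sqr_trace_le_fro n (A : 'M[C]_n) : `|\tr A| ^+ 2 <= n%:R * fro A.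
Proof.
case: n A => [|n] A; first by rewrite mul0r /mxtrace big_ord0 normr0 expr0n.
pose x := \tr A / n.+1%:R.
have n0 : n.+1%:R != 0 :> C by rewrite pnatr_eq0.
have := fro_ge0 (A - x%:M); rewrite /fro.
have -> : \tr ((A - x%:M) *m (A - x%:M)^t*) =
          \tr (A *m A^t*) - `|\tr A| ^+ 2 / n.+1%:R.
  rewrite adjmxD adjmxN adj_scalar_mx mulmxBl !mulmxBr -scalar_mxM.
  rewrite !(mul_mx_scalar, mul_scalar_mx) !(raddfB, raddfD, raddfN)/=.
  rewrite !mxtraceZ mxtrace_scalar -map_trmx mxtrace_tr.
  rewrite (_ : \tr (map_mx _ A) = (\tr A)^*); last first.
    by rewrite /mxtrace raddf_sum; apply: eq_bigr => i _; rewrite mxE.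
  rewrite /x rmorphM/= fmorphV/= conjC_nat normCK.
  rewrite -[(\tr A / _ * (_ / _)) *+ _]mulr_natr.
  by move: (n.+1%:R) n0 => k n0; field.
by rewrite subr_ge0 ler_pdivrMr ?ltr0n// mulrC.
Qed.

Lemma eigen_norm_le n (A : 'M[C]_n) a z :
  opb A a -> eigenvalue A z -> `|z| ^+ 2 <= a.
Proof.
move=> hA /eigenvalueP[v vA v0]; have := hA v.
rewrite mulmxBr mulmxBl mul_mx_scalar mulmxA vA -scalemxAl.
rewrite -mulmxA -adjmxM vA adjmxZ -!scalemxAl -scalemxAr scalerA -scalerBl.
by rewrite mxE -normCK pmulr_lge0 ?row_sqnorm_gt0// subr_ge0.
Qed.

(** Eigenvalues lie in the numerical range, hence inherit the bound on the
    skew part of the matrix. *)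
Lemma eigen_Im_le n (A : 'M[C]_n) e z :
  psd (e%:M - 'i *: (A - A^t*)) -> psd (e%:M + 'i *: (A - A^t*)) ->
  eigenvalue A z -> `|'Im z| *+ 2 <= e.
Proof.
move=> h1 h2 /eigenvalueP[v vA v0].
have E : v *m ('i *: (A - A^t*)) *m v^t* = ('i * (z - z^*)) *: (v *m v^t*).
  rewrite -scalemxAr -scalemxAl mulmxBr mulmxBl vA -[v *m A^t* *m _]mulmxA.
  rewrite -[A^t* *m _]trmxCK adjmxM trmxCK trmxCK vA adjmxZ.
  by rewrite -scalemxAl -scalemxAr -scalerBl scalerA.
have E2 : 'i * (z - z^*) = - ('Im z *+ 2).
  rewrite [in LHS](Crect z) conjC_rect ?Creal_Re ?Creal_Im//.
  rewrite (_ : _ * _ = 'i ^+ 2 * 'Im z *+ 2); last by ring.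
  by rewrite sqrCi mulN1r mulNrn.
have := h1 v; have := h2 v.
rewrite mulmxBr mulmxBl mulmxDr mulmxDl E E2 mul_mx_scalar -scalemxAl.
rewrite -scalerBl -scalerDl; do 2 rewrite mxE pmulr_lge0 ?row_sqnorm_gt0//.
rewrite opprK subr_ge0 => l1 l2.
rewrite -normrMn real_ler_norml; last by rewrite rpredMn ?Creal_Im.
by rewrite l1 andbT -subr_ge0 opprK addrC.
Qed.

End psd.

Local Open Scope classical_set_scope.
Local Open Scope ring_scope.
Local Open Scope complex_scope.
Local Open Scope sesquilinear_scope.

(** * Mean values over the torus *)

Section torus.
Context {R : realType}.
Local Notation plane := (measurableTypeR R * measurableTypeR R)%type.
Local Notation mu := (@lebesgue_measure R).
Local Notation I := (`[- pi, pi]%classic : set R).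

Lemma lebesgue_arc : mu I = (2 * pi)%:E.
Proof.
rewrite lebesgue_measure_itv/= lte_fin ifT.
  by rewrite opprK -mulr2n mulr_natl.
by rewrite gtrN// pi_gt0.
Qed.

Lemma measurable_torus : measurable (torus_square : set plane).
Proof. by apply: measurableX. Qed.

Lemma leb2_torus : leb2 (torus_square : set plane) = ((2 * pi) ^+ 2)%:E.
Proof.
transitivity (mu I * mu I)%E; last by rewrite lebesgue_arc -EFinM expr2.
exact: product_measure1E.
Qed.

(** Boundedness is asked on the whole plane rather than on the torus: all the
    symbols are periodic, and closure properties then hold with no reference
    to a domain. *)
Definition bmeas (f : plane -> R) :=
  measurable_fun setT f /\ exists M, forall x, `|f x| <= M.

Lemma bmeas_integrable f : bmeas f ->
  leb2.-integrable torus_square (EFin \o f).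
Proof.
move=> [mf [M fM]]; apply: measurable_bounded_integrable.
- exact: measurable_torus.
- exact: (eq_ind_r (fun x => (x < +oo)%E) (ltry _) leb2_torus).
- exact: measurable_funTS.
- exists M; split; first exact: num_real.
  by move=> x Mx y _; apply: le_trans (ltW Mx).
Qed.

Lemma bmeas_cst c : bmeas (fun=> c).
Proof. by split; [exact: measurable_cst|exists `|c|]. Qed.

Lemma bmeasD f g : bmeas f -> bmeas g -> bmeas (fun x => f x + g x).
Proof.
move=> [mf [M fM]] [mg [N gN]]; split; first exact: measurable_funD.
by exists (M + N) => x; rewrite (le_trans (ler_normD _ _))// lerD.
Qed.

Lemma bmeasM f g : bmeas f -> bmeas g -> bmeas (fun x => f x * g x).
Proof.
move=> [mf [M fM]] [mg [N gN]]; split; first exact: measurable_funM.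
by exists (M * N) => x; rewrite normrM ler_pM.
Qed.

Lemma bmeasN f : bmeas f -> bmeas (fun x => - f x).
Proof.
move=> /(bmeasM (bmeas_cst (- 1))).
by under eq_fun do rewrite mulN1r.
Qed.

Lemma bmeas_trig k1 k2 (g : R -> R) : continuous g ->
  (forall x, `|g x| <= 1) -> bmeas (fun x => g (k1 * x.1 + k2 * x.2)).
Proof.
move=> cg g1; split; last by exists 1.
apply: measurableT_comp; first exact: continuous_measurable_fun.
apply: measurable_funD; apply: measurable_funM => //;
  by [exact: measurable_cst | exact: measurable_fst | exact: measurable_snd].
Qed.

Definition rint (f : plane -> R) : R := \int[leb2]_(x in torus_square) f x.

Lemma rintD f g : bmeas f -> bmeas g ->
  rint (fun x => f x + g x) = rint f + rint g.
Proof.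
move=> bf bg; apply: RintegralD; first exact: measurable_torus.
  exact: bmeas_integrable.
exact: bmeas_integrable.
Qed.

Lemma rintZ c f : bmeas f -> rint (fun x => c * f x) = c * rint f.
Proof.
move=> bf; apply: RintegralZl; first exact: measurable_torus.
exact: bmeas_integrable.
Qed.

Lemma rintN f : bmeas f -> rint (fun x => - f x) = - rint f.
Proof.
by move=> bf; under eq_fun do rewrite -mulN1r; rewrite rintZ// mulN1r.
Qed.

Lemma rint_cst c : rint (fun=> c) = c * (2 * pi) ^+ 2.
Proof.
rewrite /rint Rintegral_cst; last exact: measurable_torus.
by congr (c * _); exact: (congr1 fine leb2_torus).
Qed.

Lemma rint_ge0 f : (forall x, 0 <= f x) -> 0 <= rint f.
Proof. by move=> f0; exact: Rintegral_ge0. Qed.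

Lemma rint_le f g : bmeas f -> bmeas g -> (forall x, f x <= g x) ->
  rint f <= rint g.
Proof.
move=> bf bg fg; rewrite -subr_ge0 -rintN// -rintD//; last exact: bmeasN.
by apply: rint_ge0 => x; rewrite subr_ge0.
Qed.

Lemma rint_norm_le f M : bmeas f -> (forall x, `|f x| <= M) ->
  `|rint f| <= M * (2 * pi) ^+ 2.
Proof.
move=> bf fM; rewrite -rint_cst ler_norml -rintN; last exact: bmeas_cst.
rewrite !rint_le//; try exact: bmeas_cst.
- by move=> x; have := fM x; rewrite ler_norml => /andP[].
- by move=> x; have := fM x; rewrite ler_norml => /andP[].
Qed.

Lemma rint_prod (f g : R -> R) : continuous f -> continuous g ->
  (forall x, `|f x| <= 1) -> (forall x, `|g x| <= 1) ->
  rint (fun x => f x.1 * g x.2) =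
  (\int[mu]_(x in I) f x) * (\int[mu]_(x in I) g x).
Proof.
move=> cf cg f1 g1.
have mf : measurable_fun setT f by exact: continuous_measurable_fun.
have mg : measurable_fun setT g by exact: continuous_measurable_fun.
pose F (z : plane) : R := (f z.1 * g z.2).
pose h := (EFin \o (F \_ torus_square)).
have bF : bmeas F.
  split; last by exists 1 => x; rewrite normrM mulr_ile1.
  apply: measurable_funM; apply: measurableT_comp => //;
    by [exact: measurable_fst | exact: measurable_snd].
have iF := bmeas_integrable bF.
have fin1 (k : R -> R) : continuous k -> mu.-integrable I (EFin \o k).
  move=> ck; apply: continuous_compact_integrable.
    exact: segment_compact.
  exact: continuous_subspaceT.
have iF' : leb2.-integrable setT h.
  rewrite /h -restrict_EFin.
  by apply/(integrable_mkcond (EFin \o F) measurable_torus).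
have hE x y : h (x, y) = ((f \_ I) x * (g \_ I) y)%:E.
  rewrite /h /F /= !patchE /torus_square in_setX /=.
  by case: (x \in I) (y \in I) => [] []; rewrite /= ?mulr0 ?mul0r.
have ig : mu.-integrable setT (EFin \o (g \_ I)).
  rewrite -restrict_EFin; apply: (iffLR (integrable_mkcond _ _)) => //.
  exact: fin1.
have if_ : mu.-integrable setT (EFin \o (f \_ I)).
  rewrite -restrict_EFin; apply: (iffLR (integrable_mkcond _ _)) => //.
  exact: fin1.
have FE x : fubini_F mu h x = ((f \_ I) x * \int[mu]_(y in I) g y)%:E.
  transitivity (\int[mu]_y (((f \_ I) x)%:E * (EFin \o (g \_ I)) y))%E.
    by apply: eq_integral => y _; rewrite hE EFinM.
  rewrite integralZl// EFinM; congr (_ * _)%E.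
  rewrite Rintegral_mkcond /Rintegral fineK//; exact: integrable_fin_num.
rewrite /rint Rintegral_mkcond.
transitivity (fine (\int[mu]_x fubini_F mu h x)%E).
  by congr fine; apply/esym; exact: integral12_prod_meas1.
transitivity (\int[mu]_x ((f \_ I) x * \int[mu]_(y in I) g y)).
  by congr fine; apply: eq_integral => x _; rewrite FE.
by rewrite RintegralZr// -Rintegral_mkcond.
Qed.

Lemma sin_intpi (k : int) : sin (k%:~R * pi) = 0 :> R.
Proof.
have H (n : nat) : sin (n%:R * pi) = 0 :> R.
  elim: n => [|n IH]; first by rewrite mul0r sin0.
  by rewrite -natr1 mulrDl mul1r sinDpi IH oppr0.
case: k => n; first exact: H.
by rewrite NegzE mulrNz mulNr sinN H oppr0.
Qed.

(** The fundamental theorem of calculus on a full period. *)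
Lemma integral_arc_deriv (f F : R -> R) : continuous f ->
  (forall x : R, is_derive x 1 F (f x)) ->
  \int[mu]_(x in I) f x = F pi - F (- pi).
Proof.
move=> cf dF; rewrite /Rintegral.
have cF : continuous F.
  move=> x; apply: differentiable_continuous.
  by apply/derivable1_diffP; have [] := dF x.
rewrite (continuous_FTC2 (F := F))//.
- by rewrite gtrN// pi_gt0.
- exact: continuous_subspaceT.
- split.
  + by move=> x _; have [] := dF x.
  + by apply: cvg_at_right_filter; exact: cF.
  + by apply: cvg_at_left_filter; exact: cF.
- by move=> x _; rewrite derive1E; have [] := dF x.
Qed.

Lemma integral_arc_cos (k : int) :
  \int[mu]_(x in I) cos (k%:~R * x) = (k == 0)%:R * (2 * pi).
Proof.
have [->|k0] := eqVneq k 0.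
  transitivity (\int[mu]_(x in I) (1 : R)).
    by apply: eq_Rintegral => x _; rewrite mul0r cos0.
  rewrite Rintegral_cst//; congr (_ * _); exact: (congr1 fine lebesgue_arc).
have k0' : k%:~R != 0 :> R by rewrite intr_eq0.
have H (x : R) :
    is_derive x 1 (fun x => (k%:~R)^-1 * sin (k%:~R * x)) (cos (k%:~R * x)).
  have d : is_derive x 1 ( *%R k%:~R) (k%:~R : R).
    by apply: (is_derive_eq (is_deriveZ k%:~R _)); rewrite -[RHS]mulr1.
  apply: (is_derive_eq (is_deriveZ k%:~R^-1
    (is_derive1_comp (is_derive_sin (k%:~R * x)) d))).
  by rewrite /GRing.scale /= mulrCA mulVf ?mulr1.
apply: etrans (integral_arc_deriv _ H) _.
  by move=> x; apply: continuous_comp;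
    [exact: mulrl_continuous|exact: continuous_cos].
by rewrite mulrN sinN sin_intpi oppr0 mulr0 subr0 mul0r.
Qed.

Lemma integral_arc_sin (k : int) : \int[mu]_(x in I) sin (k%:~R * x) = 0.
Proof.
have [->|k0] := eqVneq k 0.
  transitivity (\int[mu]_(x in I) (0 : R)).
    by apply: eq_Rintegral => x _; rewrite mul0r sin0.
  by rewrite Rintegral_cst// mul0r.
have k0' : k%:~R != 0 :> R by rewrite intr_eq0.
have H (x : R) :
    is_derive x 1 (fun x => (- k%:~R)^-1 * cos (k%:~R * x)) (sin (k%:~R * x)).
  have d : is_derive x 1 ( *%R k%:~R) (k%:~R : R).
    by apply: (is_derive_eq (is_deriveZ k%:~R _)); rewrite -[RHS]mulr1.
  apply: (is_derive_eq (is_deriveZ (- k%:~R)^-1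
    (is_derive1_comp (is_derive_cos (k%:~R * x)) d))).
  by rewrite /GRing.scale /= invrN !mulNr mulrN opprK mulrCA mulVf ?mulr1.
apply: etrans (integral_arc_deriv _ H) _.
  by move=> x; apply: continuous_comp;
    [exact: mulrl_continuous|exact: continuous_sin].
by rewrite mulrN cosN subrr.
Qed.

End torus.

Section average.
Context {R : realType}.
Local Notation plane := (measurableTypeR R * measurableTypeR R)%type.

Lemma ReD (z w : R[i]) : complex.Re (z + w) = complex.Re z + complex.Re w.
Proof. by case: z w => [? ?] []. Qed.
Lemma ImD (z w : R[i]) : complex.Im (z + w) = complex.Im z + complex.Im w.
Proof. by case: z w => [? ?] []. Qed.
Lemma ReM (z w : R[i]) : complex.Re (z * w) =
  complex.Re z * complex.Re w - complex.Im z * complex.Im w.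
Proof. by case: z w => [? ?] []. Qed.
Lemma ImM (z w : R[i]) : complex.Im (z * w) =
  complex.Re z * complex.Im w + complex.Im z * complex.Re w.
Proof. by case: z w => [? ?] []. Qed.

Lemma expi0 : expi 0 = 1 :> R[i].
Proof. by rewrite /expi cos0 sin0. Qed.

Lemma expiD (a b : R) : expi (a + b) = expi a * expi b.
Proof.
apply/eqP; rewrite eq_complex ReM ImM /= cosD sinD addrC eqxx addrC.
by rewrite (mulrC (cos a)) mulrC eqxx.
Qed.

Lemma conj_expi (a : R) : (expi a)^*%R = expi (- a).
Proof. by rewrite /expi cosN sinN. Qed.

Definition cbmeas (f : plane -> R[i]) :=
  bmeas (fun x => complex.Re (f x)) /\ bmeas (fun x => complex.Im (f x)).

Lemma cbmeas_cst c : cbmeas (fun=> c).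
Proof. by split; exact: bmeas_cst. Qed.

Lemma cbmeasD f g : cbmeas f -> cbmeas g -> cbmeas (fun x => f x + g x).
Proof.
move=> [f1 f2] [g1 g2]; split.
- by under eq_fun do rewrite ReD; exact: bmeasD.
- by under eq_fun do rewrite ImD; exact: bmeasD.
Qed.

Lemma cbmeasM f g : cbmeas f -> cbmeas g -> cbmeas (fun x => f x * g x).
Proof.
move=> [f1 f2] [g1 g2]; split.
- under eq_fun do rewrite ReM.
  by apply: bmeasD; [exact: bmeasM|apply: bmeasN; exact: bmeasM].
- by under eq_fun do rewrite ImM; apply: bmeasD; exact: bmeasM.
Qed.

Lemma cbmeas_sum (T : Type) (s : seq T) (F : T -> plane -> R[i]) :
  (forall i, cbmeas (F i)) -> cbmeas (fun x => \sum_(i <- s) F i x).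
Proof.
move=> bF; elim: s => [|i s IH].
  by under eq_fun do rewrite big_nil; exact: cbmeas_cst.
by under eq_fun do rewrite big_cons; exact: cbmeasD.
Qed.

Lemma cbmeas_expi (a b : R) : cbmeas (fun x => expi (a * x.1 + b * x.2)).
Proof.
split => /=.
- apply: bmeas_trig; first exact: continuous_cos.
  by move=> x; rewrite ler_norml cos_geN1 cos_le1.
- apply: bmeas_trig; first exact: continuous_sin.
  by move=> x; rewrite ler_norml sin_geN1 sin_le1.
Qed.

(** The mean over the torus, which is also the zeroth Fourier coefficient. *)
Definition tavg (f : plane -> R[i]) : R[i] :=
  (((2 * pi) ^+ 2)^-1)%:C * cintegral leb2 torus_square f.

Let K := (((2 * pi) ^+ 2)^-1 : R).
Let K0 : 0 < K.
Proof. by rewrite invr_gt0 exprn_gt0// mulr_gt0// pi_gt0. Qed.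

Lemma tavgE f : tavg f = (K * rint (fun x => complex.Re (f x))) +i*
                         (K * rint (fun x => complex.Im (f x))).
Proof. by rewrite /tavg /cintegral; simpc. Qed.

Lemma tavgD f g : cbmeas f -> cbmeas g ->
  tavg (fun x => f x + g x) = tavg f + tavg g.
Proof.
move=> [f1 f2] [g1 g2]; rewrite !tavgE.
under eq_fun do rewrite ReD.
under [X in _ +i* (_ * rint X)]eq_fun do rewrite ImD.
by rewrite !rintD// !mulrDr.
Qed.

Lemma tavgZ c f : cbmeas f -> tavg (fun x => c * f x) = c * tavg f.
Proof.
case: c => a b [f1 f2]; rewrite !tavgE.
under eq_fun do rewrite ReM.
under [X in _ +i* (_ * rint X)]eq_fun do rewrite ImM.
have B k h : bmeas h -> bmeas (fun x : plane => k * h x).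
  by move=> bh; apply: bmeasM => //; exact: bmeas_cst.
rewrite !rintD ?rintN ?rintZ//; try exact: B.
- by simpc; congr (_ +i* _); rewrite [complex.Re _]/= [complex.Im _]/=; ring.
- by apply: bmeasN; exact: B.
Qed.

Lemma tavg_cst c : tavg (fun=> c) = c.
Proof.
rewrite tavgE !rint_cst; case: c => a b /=.
have K0' : (2 * pi) ^+ 2 != 0 :> R.
  by rewrite expf_neq0// mulf_neq0// gt_eqF// pi_gt0.
by rewrite /K !(mulrC _^-1) !mulfK.
Qed.

Lemma tavg_sum (T : Type) (s : seq T) (F : T -> plane -> R[i]) :
  (forall i, cbmeas (F i)) ->
  tavg (fun x => \sum_(i <- s) F i x) = \sum_(i <- s) tavg (F i).
Proof.
move=> bF; elim: s => [|i s IH].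
  by rewrite big_nil; under eq_fun do rewrite big_nil; exact: tavg_cst.
rewrite big_cons -IH -tavgD//; last exact: cbmeas_sum.
by congr tavg; apply/funext => x; rewrite big_cons.
Qed.

Lemma tavg_ge0 f : (forall x, 0 <= f x) -> 0 <= tavg f.
Proof.
move=> f0; rewrite tavgE.
have -> : (fun x => complex.Im (f x)) = fun=> 0.
  by apply/funext => x; rewrite ger0_Im.
rewrite rint_cst mul0r mulr0 ler0c; apply: mulr_ge0; first exact: ltW K0.
by apply: rint_ge0 => x; have := f0 x; rewrite lecE => /andP[].
Qed.

Lemma tavg_conj f : cbmeas f -> tavg (fun x => (f x)^*%R) = (tavg f)^*%R.
Proof.
move=> [f1 f2]; rewrite !tavgE.
have -> : (fun x => complex.Re (f x)^*%R) = (fun x => complex.Re (f x)).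
  by apply/funext => x; case: (f x).
have -> : (fun x => complex.Im (f x)^*%R) = (fun x => - complex.Im (f x)).
  by apply/funext => x; case: (f x).
by rewrite rintN// mulrN.
Qed.

Lemma normc_le_ReIm (z : R[i]) :
  `|z| <= (`|complex.Re z| + `|complex.Im z|)%:C.
Proof.
rewrite [z in `|z|]complexE (le_trans (ler_normD _ _))// normrM.
rewrite complexiE normCi mul1r !normc_def/= expr0n/= !addr0 !sqrtr_sqr.
by rewrite rmorphD.
Qed.

Lemma normc_ge_Im (z : R[i]) : `|complex.Im z|%:C <= `|z|.
Proof.
rewrite -[X in `|X|%:C]opprK -ReiNIm normrN (le_trans (normc_ge_Re _))//.
by rewrite normrM complexiE normCi mulr1.
Qed.

(** The factor two comes from bounding the real and imaginary parts
    separately. *)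
Lemma tavg_norm_le f (M : R) : cbmeas f -> (forall x, `|f x| <= M%:C) ->
  `|tavg f| <= (M *+ 2)%:C.
Proof.
move=> [f1 f2] fM; apply: (le_trans (normc_le_ReIm _)).
rewrite tavgE /= lecR mulr2n.
have E : M = K * (M * (2 * pi) ^+ 2).
  by rewrite mulrCA mulVf ?mulr1// gt_eqF// exprn_gt0// mulr_gt0// pi_gt0.
rewrite !normrM !(gtr0_norm K0) {1 2}E.
rewrite lerD// ler_pM2l// rint_norm_le// => x;
  rewrite -lecR (le_trans _ (fM x))//.
- exact: normc_ge_Re.
- exact: normc_ge_Im.
Qed.

(** Orthogonality of the exponentials. *)
Lemma tavg_expi (k1 k2 : int) :
  tavg (fun x => expi (k1%:~R * x.1 + k2%:~R * x.2)) =
  ((k1 == 0) && (k2 == 0))%:R.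
Proof.
have cM (g : R -> R) (k : R) :
    continuous g -> continuous (fun x : R => g (k * x)).
  move=> cg x; apply: continuous_comp; [exact: mulrl_continuous|exact: cg].
have c1 (x : R) : `|cos x| <= 1 :> R by rewrite ler_norml cos_geN1 cos_le1.
have s1 (x : R) : `|sin x| <= 1 :> R by rewrite ler_norml sin_geN1 sin_le1.
have cc := @cM _ _ (@continuous_cos R).
have cs := @cM _ _ (@continuous_sin R).
have bm (f g : R -> R) : continuous f -> continuous g ->
  (forall x, `|f x| <= 1) -> (forall x, `|g x| <= 1) ->
  bmeas (fun x : plane => f x.1 * g x.2).
  move=> cf cg f1 g1; split; last by exists 1 => x; rewrite normrM mulr_ile1.
  by apply: measurable_funM; apply: measurableT_comp;
    try exact: continuous_measurable_fun; try exact: measurable_fst;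
    exact: measurable_snd.
rewrite tavgE /=.
under eq_fun do rewrite cosD.
under [X in _ +i* (_ * rint X)]eq_fun do rewrite sinD.
have B (f g : R -> R) (k l : R) : continuous f -> continuous g ->
  (forall x, `|f x| <= 1) -> (forall x, `|g x| <= 1) ->
  bmeas (fun x : plane => f (k * x.1) * g (l * x.2)).
  move=> cf cg f1 g1.
  exact: (bm _ _ (cM _ k cf) (cM _ l cg) (fun x => f1 _) (fun x => g1 _)).
have ccos := @continuous_cos R; have csin := @continuous_sin R.
have Bcc := B cos cos _ _ ccos ccos c1 c1.
have Bss := B sin sin _ _ csin csin s1 s1.
have Bsc := B sin cos _ _ csin ccos s1 c1.
have Bcs := B cos sin _ _ ccos csin c1 s1.
rewrite !rintD ?rintN//; last exact: bmeasN.
have P (f g : R -> R) (k l : R) : continuous f -> continuous g ->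
  (forall x, `|f x| <= 1) -> (forall x, `|g x| <= 1) ->
  rint (fun x => f (k * x.1) * g (l * x.2)) =
  (\int[lebesgue_measure]_(x in `[- pi, pi]%classic) f (k * x)) *
  (\int[lebesgue_measure]_(x in `[- pi, pi]%classic) g (l * x)).
  move=> cf cg f1 g1.
  exact: (rint_prod (cM _ k cf) (cM _ l cg) (fun x => f1 _) (fun x => g1 _)).
rewrite (P cos cos) ?(P sin sin) ?(P sin cos) ?(P cos sin)//.
rewrite !integral_arc_cos !integral_arc_sin !(mul0r, mulr0, subr0, addr0).
have K0' : (2 * pi) ^+ 2 != 0 :> R.
  by rewrite expf_neq0// mulf_neq0// gt_eqF// pi_gt0.
case: (k1 == 0); case: (k2 == 0); rewrite /= ?(mul0r, mulr0, mul1r)//.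
by rewrite -expr2 mulVf.
Qed.

End average.

(** * Toeplitz matrices as compressions of multiplication operators *)

Section toeplitz.
Context {R : realType}.
Local Notation plane := (measurableTypeR R * measurableTypeR R)%type.
Implicit Types (f g : R * R -> R[i]) (n : nat).

Definition realv (f : R * R -> R[i]) := forall x, (f x)^*%R = f x.

(** The exponential attached to a position, so that the entries of [T_n(f)] are
    the Gram-like means [f * wave k * (wave l)^*]; compare [toeplitzE]. *)
Definition wave n (k : 'I_(n * n)) (th : R * R) : R[i] :=
  expi (- ((lex1 k)%:R * th.1 + (lex2 k)%:R * th.2)).

Lemma cbmeas_wave n (k : 'I_(n * n)) : cbmeas (wave k).
Proof.
rewrite /wave; under eq_fun do rewrite opprD -!mulNr.
exact: cbmeas_expi.
Qed.

Lemma cbmeas_conj (f : plane -> R[i]) : cbmeas f -> cbmeas (fun x => (f x)^*%R).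
Proof.
move=> [f1 f2]; split.
- by rewrite (_ : (fun x => _) = (fun x => complex.Re (f x)))//;
    apply/funext => x; case: (f x).
- rewrite (_ : (fun x => _) = (fun x => - complex.Im (f x))); last first.
    by apply/funext => x; case: (f x).
  exact: bmeasN.
Qed.

Lemma toeplitzE n f (k l : 'I_(n * n)) :
  toeplitz n f k l = tavg (fun th => f th * (wave k th * (wave l th)^*%R)).
Proof.
rewrite mxE /fourier_coef -/(tavg _); congr tavg; apply/funext => th.
congr (_ * _); rewrite /wave conj_expi -expiD; congr expi.
have E (a b c d x y : R) : - ((a - b) * x + (c - d) * y) =
    - (a * x + c * y) - - (b * x + d * y) by ring.
rewrite !rmorphB/= -?pmulrn; exact: E.
Qed.

Lemma cbmeas_wave2 n (k l : 'I_(n * n)) :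
  cbmeas (fun th => wave k th * (wave l th)^*%R).
Proof.
apply: cbmeasM; first exact: cbmeas_wave.
by apply: cbmeas_conj; exact: cbmeas_wave.
Qed.

Lemma toeplitzD n f g : cbmeas f -> cbmeas g ->
  toeplitz n (fun x => f x + g x) = toeplitz n f + toeplitz n g.
Proof.
move=> bf bg; apply/matrixP => k l; rewrite [RHS]mxE !toeplitzE.
rewrite -tavgD; try (by apply: cbmeasM => //; exact: cbmeas_wave2).
by congr tavg; apply/funext => x; rewrite mulrDl.
Qed.

Lemma toeplitzZ n c f : cbmeas f ->
  toeplitz n (fun x => c * f x) = c *: toeplitz n f.
Proof.
move=> bf; apply/matrixP => k l; rewrite [RHS]mxE !toeplitzE.
rewrite -tavgZ; last by apply: cbmeasM => //; exact: cbmeas_wave2.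
by congr tavg; apply/funext => x; rewrite -mulrA.
Qed.

Lemma toeplitzB n f g : cbmeas f -> cbmeas g ->
  toeplitz n (fun x => f x - g x) = toeplitz n f - toeplitz n g.
Proof.
move=> bf bg; rewrite -scaleN1r -toeplitzZ// -toeplitzD//.
  by congr toeplitz; apply/funext => x; rewrite mulN1r.
by apply: cbmeasM => //; exact: cbmeas_cst.
Qed.

Lemma toeplitz_sum n (T : Type) (s : seq T) (F : T -> R * R -> R[i]) :
  (forall i, cbmeas (F i)) ->
  toeplitz n (fun x => \sum_(i <- s) F i x) = \sum_(i <- s) toeplitz n (F i).
Proof.
move=> bF; elim: s => [|i s IH].
  rewrite big_nil; under eq_fun do rewrite big_nil -[0](mul0r 1).
  by rewrite toeplitzZ ?scale0r//; exact: cbmeas_cst.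
rewrite big_cons -IH -toeplitzD//; last exact: cbmeas_sum.
by congr toeplitz; apply/funext => x; rewrite big_cons.
Qed.

Lemma toeplitz_adj n f : cbmeas f -> realv f ->
  (toeplitz n f)^t* = toeplitz n f.
Proof.
move=> bf rf; apply/matrixP => k l; rewrite [LHS]mxE [_^T _ _]mxE !toeplitzE.
rewrite -tavg_conj; last by apply: cbmeasM => //; exact: cbmeas_wave2.
congr tavg; apply/funext => x.
by rewrite rmorphM/= rf rmorphM/= conjCK [X in _ * X]mulrC.
Qed.

(** [v T(f) v^*] is the mean of [f |V|^2], where [V] is the trigonometric
    polynomial with coefficients [v]. *)
Lemma psd_toeplitz n f : cbmeas f -> (forall x, 0 <= f x) ->
  psd (toeplitz n f).
Proof.
move=> bf f0 v.
have -> : (v *m toeplitz n f *m v^t*) 0 0 =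
  tavg (fun x => f x * `|\sum_k v 0 k * wave k x| ^+ 2).
  transitivity (tavg (fun x => \sum_l \sum_k
      (v 0 l)^*%R * v 0 k * (f x * (wave k x * (wave l x)^*%R)))).
    have B l k : cbmeas (fun x : R * R =>
        (v 0 l)^*%R * v 0 k * (f x * (wave k x * (wave l x)^*%R))).
      apply: cbmeasM; first exact: cbmeas_cst.
      by apply: cbmeasM => //; exact: cbmeas_wave2.
    rewrite tavg_sum; last by move=> l; exact: cbmeas_sum.
    rewrite mxE; apply: eq_bigr => l _.
    rewrite tavg_sum// !mxE mulr_suml; apply: eq_bigr => k _.
    rewrite toeplitzE tavgZ; last by apply: cbmeasM => //; exact: cbmeas_wave2.
    by rewrite mulrC mulrA.
  congr tavg; apply/funext => x.
  rewrite normCK rmorph_sum/= mulr_suml mulr_sumr exchange_big/=.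
  apply: eq_bigr => k _; rewrite !mulr_sumr; apply: eq_bigr => l _.
  by rewrite rmorphM/=; ring.
by apply: tavg_ge0 => x; rewrite mulr_ge0// exprn_ge0.
Qed.

Lemma lex_inj n (k l : 'I_(n * n)) :
  lex1 k = lex1 l -> lex2 k = lex2 l -> k = l.
Proof.
move=> [h1] [h2]; apply/val_inj.
by rewrite /= (divn_eq k n) (divn_eq l n) h1 h2.
Qed.

Definition expo (a b : int) (th : R * R) : R[i] :=
  expi (a%:~R * th.1 + b%:~R * th.2).

Lemma toeplitz_expo n a b (k l : 'I_(n * n)) : toeplitz n (expo a b) k l =
  (((lex1 k)%:Z - (lex1 l)%:Z == a) && ((lex2 k)%:Z - (lex2 l)%:Z == b))%:R.
Proof.
rewrite mxE /fourier_coef -/(tavg _).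
transitivity (tavg (fun x : R * R => expi
   ((a - ((lex1 k)%:Z - (lex1 l)%:Z))%:~R * x.1 +
    (b - ((lex2 k)%:Z - (lex2 l)%:Z))%:~R * x.2))).
  congr tavg; apply/funext => x; rewrite /expo -expiD; congr expi.
  have E (p q r s t u : R) : p * t + q * u + - (r * t + s * u) =
    (p - r) * t + (q - s) * u by ring.
  rewrite !(rmorphB _ a) !(rmorphB _ b); exact: E.
by rewrite tavg_expi !subr_eq0 ![_ == (_ - _)]eq_sym.
Qed.

Lemma cbmeas_expo a b : cbmeas (expo a b).
Proof. exact: cbmeas_expi. Qed.

Lemma toeplitz_cst n (c : R[i]) : toeplitz n (fun=> c) = c%:M.
Proof.
transitivity (toeplitz n (fun x => c * expo 0 0 x)).
  congr toeplitz; apply/funext => x.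
  by rewrite /expo !mul0r addr0 expi0 mulr1.
rewrite toeplitzZ; last exact: cbmeas_expo.
rewrite -scalemx1; congr (_ *: _); apply/matrixP => k l.
rewrite toeplitz_expo mxE !subr_eq0; congr (nat_of_bool _)%:R.
apply/idP/eqP => [/andP[/eqP[h1] /eqP[h2]]|->]; last by rewrite !eqxx.
by apply: lex_inj; rewrite /lex1 /lex2 ?h1 ?h2.
Qed.

Lemma opb_toeplitz n f (G : R) : cbmeas f -> realv f -> 0 < G ->
  (forall x, `|f x| <= G%:C) -> opb (toeplitz n f) (G ^+ 2)%:C.
Proof.
move=> bf rf G0 fG.
have fR x : f x \is Num.real by apply/CrealP.
have bG : cbmeas (fun=> G%:C) by exact: cbmeas_cst.
have h x : - G%:C <= f x <= G%:C by rewrite -real_ler_norml.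
rewrite rmorphXn/=; apply: opb_herm; [by rewrite ltcR|exact: toeplitz_adj|..].
- rewrite -toeplitz_cst -toeplitzB//; apply: psd_toeplitz.
    by apply: cbmeasD => //; have := cbmeasM (cbmeas_cst (- 1)) bf;
      under eq_fun do rewrite mulN1r.
  by move=> x; rewrite subr_ge0; case/andP: (h x).
- rewrite -toeplitz_cst -toeplitzD//; apply: psd_toeplitz.
    exact: cbmeasD.
  by move=> x; rewrite -lerBlDl sub0r; case/andP: (h x).
Qed.

End toeplitz.

(** * Products of truncated shifts *)

Section shifts.

(** Coordinates are one-based, as in [lex1] and [lex2]. *)
Definition inbox (n : nat) (x y : int) : bool :=
  (0 < x <= n%:Z) && (0 < y <= n%:Z).

(** The exiting indices form a block of length at most [`|b|] at the end of the
    interval when [b >= 0], at its beginning otherwise. *)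
Lemma card_ord_exit (n : nat) (b : int) :
  (#|[set i : 'I_n | ~~ (0%R < i.+1%:Z + b <= n%:Z)%R]%SET| <= `|b|)%N.
Proof.
set S := [set i | _]%SET.
pose g (i : 'I_n) := if 0%R <= b then (n.-1 - i)%N else i : nat.
rewrite cardE -(size_map g) -[leqRHS](size_iota 0); apply: uniq_leq_size.
  rewrite map_inj_uniq ?enum_uniq// => i j; rewrite /g.
  have := ltn_ord i; have := ltn_ord j.
  by case: ifP => _ hj hi h; apply/val_inj => /=; lia.
move=> _ /mapP[i + ->]; rewrite mem_enum inE mem_iota /g.
by have := ltn_ord i; case: ifP; lia.
Qed.

Lemma lex_surj (n : nat) x y : inbox n x y ->
  exists m : 'I_(n * n), (lex1 m)%:Z = x /\ (lex2 m)%:Z = y.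
Proof.
move=> hxy; have [x' [y' [ex ey xn yn]]] : exists x' y' : nat,
    [/\ x = x'.+1%:Z, y = y'.+1%:Z, (x' < n)%N & (y' < n)%N].
  by exists `|x|.-1, `|y|.-1; move: hxy; rewrite /inbox; split; lia.
rewrite {}ex {}ey {hxy x y}; move: x' y' xn yn => x y xn yn.
have h : (x * n + y < n * n)%N by nia.
exists (Ordinal h); rewrite /lex1 /lex2 /=.
by rewrite divnMDl ?modnMDl ?divn_small ?modn_small ?addn0//; lia.
Qed.

Lemma card_box_exit (n : nat) (b1 b2 : int) :
  (#|[set l : 'I_(n * n) |
        ~~ inbox n ((lex1 l)%:Z + b1) ((lex2 l)%:Z + b2)]%SET|
     <= n * (`|b1| + `|b2|))%N.
Proof.
set S := [set l | _]%SET.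
have H1 (l : 'I_(n * n)) : (l %/ n < n)%N.
  by have := ltn_ord l; case: n {S} l => [|n] l lt//; rewrite ltn_divLR.
have H2 (l : 'I_(n * n)) : (l %% n < n)%N.
  by have := ltn_ord l; case: n {S H1} l => [|n] l lt//; rewrite ltn_mod.
pose phi l := (Ordinal (H1 l), Ordinal (H2 l)).
have phi_inj : injective phi.
  move=> k l [h1 h2]; apply: lex_inj; rewrite /lex1 /lex2 ?h1 ?h2//.
pose S' b := [set i : 'I_n | ~~ (0%R < i.+1%:Z + b <= n%:Z)%R]%SET.
rewrite -(card_imset _ phi_inj).
apply: (@leq_trans #|(finset.setX (S' b1) [set: 'I_n] :|:
                      finset.setX [set: 'I_n] (S' b2))%SET|).
  apply/subset_leq_card/fintype.subsetP => _ /imsetP[l + ->].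
  by rewrite !inE /inbox negb_and andbT.
apply: leq_trans (leq_card_setU _ _) _.
rewrite !cardsX cardsT card_ord mulnDr; apply: leq_add.
  by rewrite mulnC leq_mul2l card_ord_exit orbT.
by rewrite leq_mul2l card_ord_exit orbT.
Qed.

End shifts.

Section asymptotics.
Context {R : realType}.
Local Notation plane := (measurableTypeR R * measurableTypeR R)%type.
Local Notation mxseq := (forall n : nat, 'M[R[i]]_(n * n)).
Implicit Types (f g : R * R -> R[i]) (X Y Z : mxseq) (e : R[i]).

Lemma expoD a b c d (x : R * R) :
  expo a b x * expo c d x = expo (a + c) (b + d) x.
Proof. by rewrite /expo -expiD; congr expi; rewrite !rmorphD/=; ring. Qed.

(** The product of two truncated shifts is the truncation of the product
    shift, except in the columns that the right factor pushes out of the box. *)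
Lemma fro_shift_mul n (a b c d : int) :
  fro (toeplitz n (expo a b) *m toeplitz n (expo c d) -
       toeplitz n (@expo R (a + c) (b + d))) <=
  (n * (`|c| + `|d|))%N%:R.
Proof.
set X := _ - _; rewrite froE exchange_big/=.
pose out (l : 'I_(n * n)) := ~~ inbox n ((lex1 l)%:Z + c) ((lex2 l)%:Z + d).
apply: (@le_trans _ _ (\sum_(l < n * n) (out l)%:R)); last first.
  rewrite -natr_sum ler_nat; apply: leq_trans (card_box_exit n c d).
  rewrite -sum1_card [leqRHS]big_mkcond/=; apply: leq_sum => l _.
  by rewrite inE -/(out l); case: (out l).
apply: ler_sum => l _.
pose D (k m : 'I_(n * n)) (p q : int) :=
  ((lex1 k)%:Z - (lex1 m)%:Z == p) && ((lex2 k)%:Z - (lex2 m)%:Z == q).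
have XE k : X k l = (\sum_(m < n * n) (D k m a b)%:R * (D m l c d)%:R) -
                    (D k l (a + c) (b + d))%:R.
  rewrite mxE [(_ *m _) _ _]mxE [X in _ + X]mxE toeplitz_expo; congr (_ - _).
  by apply: eq_bigr => m _; rewrite !toeplitz_expo.
have [lo|li] := boolP (out l); last first.
  have [m [m1 m2]] := lex_surj (negbNE li).
  rewrite big1// => k _; rewrite XE (bigD1 m)//= big1 ?addr0; last first.
    move=> m' m'm; have -> : D m' l c d = false; last by rewrite mulr0.
    apply/negP => /andP[/eqP h1 /eqP h2]; case/eqP: m'm.
    by apply: lex_inj; lia.
  have -> : D m l c d = true by rewrite /D; lia.
  have -> : D k m a b = D k l (a + c) (b + d) by rewrite /D; lia.
  by rewrite mulr1 subrr normr0 expr0n.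
have XE' k : `|X k l| ^+ 2 = (D k l (a + c) (b + d))%:R.
  rewrite XE big1 ?sub0r ?normrN.
    by case: (D _ _ _ _); rewrite ?normr1 ?normr0 ?expr1n ?expr0n.
  move=> m _; have -> : D m l c d = false; last by rewrite mulr0.
  apply: contraNF lo => /andP[/eqP h1 /eqP h2]; rewrite /inbox.
  have := ltn_ord m; have := divn_eq m n; have [n0|n0] := posnP n.
    have nn : (n * n = 0)%N by rewrite n0.
    by move=> _; rewrite [X in (_ < X)%N]nn.
  have := ltn_pmod m n0; move: h1 h2; rewrite /lex1 /lex2.
  move: (m %/ n)%N (m %% n)%N (l %/ n)%N (l %% n)%N => p q r s.
  by move=> h1 h2 h4 -> h3; have : (p < n)%N by [nia]; lia.
under eq_bigr do rewrite XE'.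
case: (pickP (fun k => D k l (a + c) (b + d))) => [k0 hk0|none]; last first.
  by rewrite big1// => k _; rewrite none.
rewrite (bigD1 k0)//= hk0 big1 ?addr0// => k kk0.
have -> // : D k l (a + c) (b + d) = false.
apply/negP => hk; case/eqP: kk0.
by move: hk hk0; rewrite /D => hk hk0; apply: lex_inj; lia.
Qed.

End asymptotics.

(** * Asymptotic multiplicativity of Toeplitz sequences *)

Section asymp.
Context {R : realType}.
Local Notation plane := (measurableTypeR R * measurableTypeR R)%type.
Local Notation mxseq := (forall n : nat, 'M[R[i]]_(n * n)).
Implicit Types (f g : R * R -> R[i]) (X Y Z : mxseq) (e : R).

Lemma modCE (z : R[i]) : (modC z)%:C = `|z|.
Proof. by rewrite /modC normc_def. Qed.

(** The Frobenius norm is [o(n)], that is, little-o of the square root of the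
    size. *)
Definition negl X := forall e, 0 < e ->
  exists N, forall n, (N <= n)%N -> fro (X n) <= e%:C * (n * n)%:R.

Definition bounded_mx X := exists2 c : R, 0 < c &
  forall n, opb (X n) c%:C /\ opb ((X n)^t*) c%:C.

Lemma negl_le2 X Y Z (c : R) : 0 < c ->
  (forall n, fro (X n) <= c%:C * (fro (Y n) + fro (Z n))) ->
  negl Y -> negl Z -> negl X.
Proof.
move=> c0 h hY hZ e e0.
have d0 : 0 < e / (2 * c) by rewrite divr_gt0// mulr_gt0.
have [N hN] := hY _ d0; have [M hM] := hZ _ d0.
exists (maxn N M) => n; rewrite geq_max => /andP[/hN h1 /hM h2].
apply: le_trans (h n) _.
have -> : e%:C * (n * n)%:R = c%:C * ((e / (2 * c))%:C * (n * n)%:R +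
                                      (e / (2 * c))%:C * (n * n)%:R).
  rewrite -mulrDl mulrA -!rmorphD/= -rmorphM/=; congr (_%:C * _).
  by field; rewrite gt_eqF.
by rewrite ler_pM2l ?ltcR// lerD.
Qed.

Lemma neglD X Y : negl X -> negl Y -> negl (fun n => X n + Y n).
Proof.
apply: (@negl_le2 _ _ _ 2) => // n.
by rewrite [2%:C]rmorph_nat; exact: froD.
Qed.

Lemma negl_le X Y (c : R) : 0 < c ->
  (forall n, fro (X n) <= c%:C * fro (Y n)) -> negl Y -> negl X.
Proof.
move=> c0 h hY; apply: (negl_le2 c0 _ hY hY) => n.
by apply: le_trans (h n) _; rewrite ler_pM2l ?ltcR// lerDl fro_ge0.
Qed.

Lemma neglZ X c : negl X -> negl (fun n => c *: X n).
Proof.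
apply: (@negl_le _ _ (modC c ^+ 2 + 1)) => [|n].
  by rewrite ltr_wpDl// sqr_ge0.
rewrite froZ ler_wpM2r ?fro_ge0// -modCE -rmorphXn/= lecR.
by rewrite lerDl ler01.
Qed.

Lemma negl_Mr X Y : bounded_mx Y -> negl X -> negl (fun n => X n *m Y n).
Proof.
move=> [c c0 hY]; apply: (@negl_le _ _ c) => // n.
by apply: froMr; case: (hY n).
Qed.

Lemma negl_Ml X Y : bounded_mx X -> negl Y -> negl (fun n => X n *m Y n).
Proof.
move=> [c c0 hX]; apply: (@negl_le _ _ c) => // n.
by apply: froMl; case: (hX n).
Qed.

Lemma negl0 : negl (fun n => 0).
Proof.
move=> e e0; exists 0%N => n _; rewrite /fro mul0mx mxtrace0.
by rewrite mulr_ge0// ler0c ltW.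
Qed.

Lemma negl_sum (T : Type) (s : seq T) (F : T -> mxseq) :
  (forall i, negl (F i)) -> negl (fun n => \sum_(i <- s) F i n).
Proof.
move=> h; elim: s => [|i s IH] e e0.
  by have [N hN] := negl0 e0; exists N => n /hN; rewrite big_nil.
by have [N hN] := neglD (h i) IH e0; exists N => n /hN; rewrite big_cons.
Qed.

(** This is what lets trigonometric polynomials replace general symbols: an
    operator bound [e] costs at most [e N] in squared Frobenius norm. *)
Lemma negl_approx X : (forall e, 0 < e -> exists2 Y : mxseq, negl Y &
    exists N, forall n, (N <= n)%N -> opb (X n - Y n) e%:C) -> negl X.
Proof.
move=> h e e0; have d0 : 0 < e / 4 by rewrite divr_gt0.
have [Y /(_ _ d0) [N hN] [M hM]] := h _ d0.
exists (maxn N M) => n; rewrite geq_max => /andP[/hN h1 /hM /fro_opb h2].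
rewrite -[X n](subrK (Y n)) (le_trans (froD _ _))//.
have -> : e%:C = 2 * ((e / 4)%:C + (e / 4)%:C).
  rewrite -(rmorph_nat (real_complex R) 2) -rmorphD/= -rmorphM/=; congr (_%:C).
  by field.
by rewrite -mulrA ler_pM2l// mulrDl lerD.
Qed.

Lemma negl_opb_cvg X : (forall e, 0 < e -> exists N, forall n, (N <= n)%N ->
    opb (X n) e%:C) -> negl X.
Proof.
move=> h; apply: negl_approx => e /h[N hN].
exists (fun=> 0); first exact: negl0.
by exists N => n /hN; rewrite subr0.
Qed.

Lemma nat_mul_le_sqr (K : nat) e : 0 < e ->
  exists N, forall n, (N <= n)%N -> (n * K)%N%:R <= e%:C * (n * n)%:R :> R[i].
Proof.
move=> e0; exists (Num.bound (K%:R / e)) => n hn.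
rewrite -!(rmorph_nat (real_complex R)) -rmorphM/= lecR !natrM mulrCA.
rewrite ler_wpM2l// mulrC -ler_pdivrMr//.
have : K%:R / e <= (Num.bound (K%:R / e))%:R.
  by apply: ltW; apply: archi_boundP; rewrite divr_ge0// ltW.
by move=> /le_trans; apply; rewrite ler_nat.
Qed.

Lemma trig_polynomial_cbmeas f : trig_polynomial f -> cbmeas f.
Proof.
move=> [s hs].
rewrite (_ : f = fun th => \sum_(p <- s) p.1 * expo p.2.1 p.2.2 th).
  apply: cbmeas_sum => p; apply: cbmeasM; first exact: cbmeas_cst.
  exact: cbmeas_expo.
by apply/funext => th; rewrite hs.
Qed.

Lemma toeplitz_trig (s : seq (R[i] * (int * int))) n :
  toeplitz n (fun th => \sum_(p <- s) p.1 * expo p.2.1 p.2.2 th) =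
  \sum_(p <- s) p.1 *: toeplitz n (expo p.2.1 p.2.2).
Proof.
rewrite toeplitz_sum => [|p].
  by apply: eq_bigr => p _; rewrite toeplitzZ//; exact: cbmeas_expo.
by apply: cbmeasM; [exact: cbmeas_cst|exact: cbmeas_expo].
Qed.

Lemma trig_polynomialM f g : trig_polynomial f -> trig_polynomial g ->
  trig_polynomial (fun x => f x * g x).
Proof.
move=> [s hs] [t ht]; exists [seq (p.1 * q.1, (p.2.1 + q.2.1, p.2.2 + q.2.2)) |
  p <- s, q <- t] => x.
rewrite hs ht big_allpairs_dep/= mulr_suml; apply: eq_bigr => p _.
rewrite mulr_sumr; apply: eq_bigr => q _.
by rewrite mulrACA -!/(expo _ _ _) expoD.
Qed.

Lemma trig_polynomialD f g : trig_polynomial f -> trig_polynomial g ->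
  trig_polynomial (fun x => f x + g x).
Proof.
by move=> [s hs] [t ht]; exists (s ++ t) => x; rewrite big_cat/= hs ht.
Qed.

Lemma trig_polynomial_cst (c : R[i]) : trig_polynomial (fun=> c).
Proof.
exists [:: (c, (0, 0))] => x.
by rewrite big_seq1/= !mul0r addr0 expi0 mulr1.
Qed.

Lemma trig_mul_negl f g : trig_polynomial f -> trig_polynomial g ->
  negl (fun n => toeplitz n f *m toeplitz n g -
                 toeplitz n (fun x => f x * g x)).
Proof.
move=> [s /funext ->] [t /funext ->].
pose F p q n : 'M[R[i]]_(n * n) := (p.1 * q.1) *:
  (toeplitz n (expo p.2.1 p.2.2) *m toeplitz n (expo q.2.1 q.2.2) -
   toeplitz n (expo (p.2.1 + q.2.1) (p.2.2 + q.2.2))).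
rewrite (_ : (fun n => _) = fun n => \sum_(p <- s) \sum_(q <- t) F p q n).
  apply: (@negl_sum _ s (fun p n => \sum_(q <- t) F p q n)) => p.
  apply: (@negl_sum _ t (F p)) => q; apply: neglZ => e e0.
  have [N hN] := nat_mul_le_sqr (`|q.2.1| + `|q.2.2|) e0.
  exists N => n /hN; apply: le_trans.
  exact: fro_shift_mul.
apply: functional_extensionality_dep => n.
rewrite !toeplitz_trig mulmx_suml.
rewrite (_ : (fun x => _) = fun x => \sum_(p <- s) \sum_(q <- t)
    (p.1 * q.1) * expo (p.2.1 + q.2.1) (p.2.2 + q.2.2) x); last first.
  apply/funext => x; rewrite mulr_suml; apply: eq_bigr => p _.
  rewrite mulr_sumr; apply: eq_bigr => q _.
  by rewrite mulrACA -!/(expo _ _ _) expoD.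
have B p q : cbmeas (fun x : R * R =>
    (p.1 * q.1) * @expo R (p.2.1 + q.2.1) (p.2.2 + q.2.2) x).
  by apply: cbmeasM; [exact: cbmeas_cst|exact: cbmeas_expo].
rewrite toeplitz_sum; last by move=> p; exact: cbmeas_sum.
rewrite -sumrB; apply: eq_bigr => p _.
rewrite mulmx_sumr toeplitz_sum// -sumrB; apply: eq_bigr => q _.
rewrite toeplitzZ; last exact: cbmeas_expo.
by rewrite -scalemxAl -scalemxAr scalerA /F scalerBr.
Qed.

End asymp.

Section symbols.
Context {R : realType}.
Local Notation plane := (measurableTypeR R * measurableTypeR R)%type.
Local Notation mxseq := (forall n : nat, 'M[R[i]]_(n * n)).
Implicit Types (f g : R * R -> R[i]) (X Y Z : mxseq) (e : R).

Definition approximable f := [/\ cbmeas f, realv f &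
  forall e, 0 < e -> exists p, [/\ trig_polynomial p, realv p &
    forall x, `|f x - p x| <= e%:C]].

Lemma realvM f g : realv f -> realv g -> realv (fun x => f x * g x).
Proof. by move=> hf hg x; rewrite rmorphM/= hf hg. Qed.

Lemma realvB f g : realv f -> realv g -> realv (fun x => f x - g x).
Proof. by move=> hf hg x; rewrite rmorphB/= hf hg. Qed.

Lemma cbmeasB f g : cbmeas f -> cbmeas g -> cbmeas (fun x => f x - g x).
Proof.
move=> bf bg; rewrite (_ : (fun x => _) = fun x => f x + (- 1) * g x).
  by apply: cbmeasD => //; apply: cbmeasM => //; exact: cbmeas_cst.
by apply/funext => x; rewrite mulN1r.
Qed.

Lemma cbmeas_bounded f : cbmeas f ->
  exists2 M : R, 0 < M & forall x, `|f x| <= M%:C.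
Proof.
move=> [[_ [M hM]] [_ [N hN]]]; exists (M + N + 1).
  by rewrite ltr_wpDl// addr_ge0// (le_trans _ (hM 0), le_trans _ (hN 0)).
move=> x; rewrite (le_trans (normc_le_ReIm _))// lecR.
by rewrite (le_trans (lerD (hM x) (hN x)))// lerDl.
Qed.

Lemma toeplitz_bounded f : cbmeas f -> realv f -> bounded_mx (toeplitz ^~ f).
Proof.
move=> bf rf; have [M M0 fM] := cbmeas_bounded bf; exists (M ^+ 2).
  by rewrite exprn_gt0.
by move=> n; rewrite toeplitz_adj//; split; exact: opb_toeplitz.
Qed.

Lemma product_approx f g (e : R) (M N : R) x p q :
  0 < e -> e <= 1 -> `|f x| <= M%:C -> `|g x| <= N%:C ->
  `|f x - p x| <= e%:C -> `|g x - q x| <= e%:C ->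
  `|f x * g x - p x * q x| <= (e * (M + N + 1))%:C :> R[i].
Proof.
move=> e0 e1 fM gN fp gq.
have -> : f x * g x - p x * q x =
    f x * (g x - q x) + (f x - p x) * (g x - (g x - q x)) by ring.
have M0 : 0 <= M by rewrite -ler0c (le_trans _ fM).
have N0 : 0 <= N by rewrite -ler0c (le_trans _ gN).
rewrite (le_trans (ler_normD _ _))// !normrM.
apply: (@le_trans _ _ (M%:C * e%:C + e%:C * (N + 1)%:C)).
  apply: lerD; apply: ler_pM => //.
  rewrite (le_trans (ler_normB _ _))// rmorphD/= lerD// (le_trans gq)//.
  by rewrite lecR.
by rewrite -!rmorphM -rmorphD/= lecR; lra.
Qed.

Lemma approximableM f g : approximable f -> approximable g ->
  approximable (fun x => f x * g x).
Proof.
move=> [bf rf hf] [bg rg hg]; split; [exact: cbmeasM|exact: realvM|].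
move=> e e0.
have [M M0 fM] := cbmeas_bounded bf; have [N N0 gN] := cbmeas_bounded bg.
have B0 : 0 < M + N + 1 by rewrite addr_gt0// addr_gt0.
pose d := Num.min 1 (e / (M + N + 1)).
have d0 : 0 < d by rewrite lt_min ltr01 divr_gt0.
have [p [tp rp hp]] := hf d d0; have [q [tq rq hq]] := hg d d0.
exists (fun x => p x * q x).
split; [exact: trig_polynomialM|exact: realvM|] => x.
have d1 : d <= 1 by rewrite ge_min lexx.
apply: le_trans (product_approx d0 d1 (fM x) (gN x) (hp x) (hq x)) _.
by rewrite lecR -ler_pdivlMr// ge_min lexx orbT.
Qed.

Lemma approximable_trig f : trig_polynomial f -> realv f -> approximable f.
Proof.
move=> tf rf; split => //; first exact: trig_polynomial_cbmeas.
by move=> e e0; exists f; split=> // x; rewrite subrr normr0 ler0c ltW.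
Qed.

(** Both products are uniformly close to those of approximating trigonometric
    polynomials, for which they differ only near the boundary of the box. *)
Lemma toeplitzM_negl f g : approximable f -> approximable g ->
  negl (fun n => toeplitz n f *m toeplitz n g -
                 toeplitz n (fun x => f x * g x)).
Proof.
move=> af ag; have [bf rf hf] := af; have [bg rg hg] := ag.
apply: negl_approx => e e0.
have [M M0 fM] := cbmeas_bounded bf; have [N N0 gN] := cbmeas_bounded bg.
pose B := M + N + 1.
have B0 : 0 < B by rewrite addr_gt0// addr_gt0.
(* The bound on the squared norm of the total error is
   [2 (2 (M^2 d^2 + d^2 B^2) + d^2 B^2) <= 10 B^2 d^2], and [d^2 <= d]. *)
pose d := Num.min 1 (e / (10 * B ^+ 2)).
have BB0 : 0 < 10 * B ^+ 2 by rewrite mulr_gt0// exprn_gt0.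
have d0 : 0 < d by rewrite lt_min ltr01 divr_gt0.
have d1 : d <= 1 by rewrite ge_min lexx.
have [p [tp rp hp]] := hf d d0; have [q [tq rq hq]] := hg d d0.
have bp := trig_polynomial_cbmeas tp; have bq := trig_polynomial_cbmeas tq.
exists (fun n => toeplitz n p *m toeplitz n q -
                 toeplitz n (fun x => p x * q x)).
  exact: trig_mul_negl.
exists 0%N => n _.
have -> : toeplitz n f *m toeplitz n g - toeplitz n (fun x => f x * g x) -
   (toeplitz n p *m toeplitz n q - toeplitz n (fun x => p x * q x)) =
   (toeplitz n f *m toeplitz n (fun x => g x - q x) +
    toeplitz n (fun x => f x - p x) *m toeplitz n q) -
   toeplitz n (fun x => f x * g x - p x * q x).
  rewrite !toeplitzB//; try exact: cbmeasM.
  rewrite mulmxBr mulmxBl.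
  move: (toeplitz n f *m toeplitz n g) (toeplitz n f *m toeplitz n q)
        (toeplitz n p *m toeplitz n q) => x y z.
  by apply/matrixP => k l; rewrite !mxE; ring.
(* [M] bounds [f], [B] bounds [q], [d] bounds the two approximation errors and
   [d * B] that of the product. *)
have E : (2 * (2 * (M ^+ 2 * d ^+ 2 + d ^+ 2 * B ^+ 2) + (d * B) ^+ 2))%:C =
  2 * (2 * ((M ^+ 2)%:C * (d ^+ 2)%:C + (d ^+ 2)%:C * (B ^+ 2)%:C) +
       ((d * B) ^+ 2)%:C) :> R[i].
  by rewrite !(rmorphM, rmorphD, rmorph_nat).
apply: (@opb_le _ _ _ (2 * (2 * (M ^+ 2 * d ^+ 2 + d ^+ 2 * B ^+ 2) +
    (d * B) ^+ 2))%:C).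
  rewrite lecR.
  have h1 : d * (10 * B ^+ 2) <= e by rewrite -ler_pdivlMr// ge_min lexx orbT.
  have h2 : d ^+ 2 <= d by rewrite expr2 ler_piMl// ltW.
  have MB : M <= B by rewrite /B; lra.
  have h3 : M ^+ 2 <= B ^+ 2 by rewrite ler_pXn2r ?nnegrE// ltW.
  have d20 : 0 <= d ^+ 2 by rewrite exprn_ge0// ltW.
  have h4 : M ^+ 2 * d ^+ 2 <= B ^+ 2 * d ^+ 2 by rewrite ler_wpM2r.
  have h5 : d ^+ 2 * (10 * B ^+ 2) <= d * (10 * B ^+ 2).
    by rewrite ler_wpM2r// ltW.
  rewrite exprMn; nra.
rewrite E; apply: opbD.
  apply: opbD; apply: opbM; try by rewrite ler0c exprn_ge0// ltW.
  - exact: opb_toeplitz.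
  - by apply: opb_toeplitz => //; [exact: cbmeasB|exact: realvB].
  - by apply: opb_toeplitz => //; [exact: cbmeasB|exact: realvB].
  - apply: opb_toeplitz => // x.
    rewrite -[q x](subKr (g x)); apply: le_trans (ler_normB _ _) _.
    apply: le_trans (lerD (gN x) (hq x)) _.
    by rewrite -rmorphD/= lecR /B; lra.
apply: opbN; apply: opb_toeplitz.
- by apply: cbmeasB; exact: cbmeasM.
- by apply: realvB; exact: realvM.
- exact: mulr_gt0.
- move=> x; exact: product_approx (fM x) (gN x) (hp x) (hq x).
Qed.

(** The three conditions together are stable under products, so the powers of
    [X] behave like [T(f^k)]: the product of two negligible-error relations
    uses the bounds, and replacing [T(f) T(g)] by [T(f g)] uses the
    approximability of the symbols. *)
Definition asymp X f := [/\ approximable f, bounded_mx X &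
  negl (fun n => X n - toeplitz n f)].

Lemma asympM X Y f g : asymp X f -> asymp Y g ->
  asymp (fun n => X n *m Y n) (fun x => f x * g x).
Proof.
move=> [af bX nX] [ag bY nY]; split; first exact: approximableM.
  have [c c0 hX] := bX; have [d d0 hY] := bY.
  exists (c * d); first exact: mulr_gt0.
  move=> n; have [h1 h2] := hX n; have [h3 h4] := hY n.
  have c0' : 0 <= c%:C by rewrite ler0c ltW.
  have d0' : 0 <= d%:C by rewrite ler0c ltW.
  rewrite (rmorphM (real_complex R)) /=; split; first exact: opbM d0' h1 h3.
  rewrite (adjmxM (X n) (Y n)) [X in opb _ X]mulrC; exact: opbM c0' h4 h2.
have [bf rf _] := af; have [bg rg _] := ag.
(* Replace the factors by Toeplitz matrices one at a time. *)
rewrite (_ : (fun n => _) = fun n => (X n *m (Y n - toeplitz n g) +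
   (X n - toeplitz n f) *m toeplitz n g) +
   (toeplitz n f *m toeplitz n g - toeplitz n (fun x => f x * g x))).
  apply: neglD; last exact: toeplitzM_negl.
  apply: neglD; first exact: negl_Ml.
  exact: (negl_Mr (toeplitz_bounded bg rg) nX).
apply: functional_extensionality_dep => n.
by rewrite mulmxBr mulmxBl !addrA !subrK.
Qed.

Lemma asymp1 : asymp (fun n => 1%:M) (fun=> 1).
Proof.
split.
- apply: approximable_trig; first exact: trig_polynomial_cst.
  by move=> x; rewrite rmorph1.
- exists 1; rewrite ?ltr01// => n.
  have h := @opb_scalar R[i] (n * n) 1; rewrite normr1 expr1n in h.
  by rewrite adj_scalar_mx conjC1; split; exact: h.
- move=> e e0; have [N hN] := negl0 e0; exists N => n /hN.
  by rewrite toeplitz_cst subrr.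
Qed.

Lemma asymp_pow X f k : asymp X f ->
  asymp (fun n => X n ^+ k) (fun x => f x ^+ k).
Proof.
move=> h; elim: k => [|k IH]; first exact: asymp1.
rewrite (_ : (fun n => _) = fun n => X n *m X n ^+ k); last first.
  by apply: functional_extensionality_dep => n; rewrite exprS.
rewrite (_ : (fun x => _) = fun x => f x * f x ^+ k); last first.
  by apply/funext => n; rewrite exprS.
exact: asympM.
Qed.

Lemma trace_toeplitz n f : cbmeas f ->
  \tr (toeplitz n f) = (n * n)%:R * tavg f.
Proof.
move=> bf; rewrite mulr_natl -{2}[(n * n)%N]card_ord -sumr_const.
apply: eq_bigr => k _; rewrite mxE /fourier_coef -/(tavg _).
congr tavg; apply/funext => x.
by rewrite !subrr !mul0r addr0 oppr0 expi0 mulr1.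
Qed.

(** Traces only see the symbol, by Cauchy-Schwarz. *)
Lemma asymp_trace X f e : 0 < e -> asymp X f ->
  exists N, forall n, (N <= n)%N ->
    `|\tr (X n) - (n * n)%:R * tavg f| <= e%:C * (n * n)%:R.
Proof.
move=> e0 [[bf _ _] _ nX]; have e20 : 0 < e ^+ 2 by rewrite exprn_gt0.
have [N hN] := nX _ e20; exists N => n /hN h.
have h1 := sqr_trace_le_fro (X n - toeplitz n f).
rewrite -trace_toeplitz// -raddfB/=.
have ee : 0 <= e%:C * (n * n)%:R by rewrite mulr_ge0// ler0c ltW.
rewrite -(@ler_pXn2r _ 2) ?nnegrE//; apply: le_trans h1 _.
rewrite exprMn -rmorphXn/= [_%:R ^+ 2]expr2 mulrCA.
by rewrite ler_wpM2l.
Qed.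

End symbols.

(** * The Weierstrass approximation theorem *)

Section weierstrass.
Context {R : realType}.
Implicit Types (phi psi : nat -> R) (f : R -> R) (x e : R).

(** Bernstein polynomials, by recursion on the last Bernoulli trial:
    [(bernstein N phi).[x]] is the mean of [phi] under the binomial
    distribution with parameters [N] and [x]. *)
Fixpoint bernstein (N : nat) phi : {poly R} :=
  if N is N'.+1 then
    'X * bernstein N' (phi \o succn) + (1 - 'X) * bernstein N' phi
  else (phi 0%N)%:P.

Lemma bernstein_le N phi psi x : 0 <= x <= 1 ->
  (forall k, (k <= N)%N -> phi k <= psi k) ->
  (bernstein N phi).[x] <= (bernstein N psi).[x].
Proof.
move=> /andP[x0 x1]; elim: N phi psi => [|N IH] phi psi h /=.
  by rewrite !hornerC h.
rewrite !hornerE lerD//; apply: ler_wpM2l; rewrite ?subr_ge0//;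
  apply: IH => k kN.
  exact: h.
by apply: h; exact: leqW.
Qed.

(** The first two moments of the binomial distribution. *)
Lemma bernstein_quadratic N (a b c x : R) :
  (bernstein N (fun k => a + b * k%:R + c * k%:R ^+ 2)).[x] =
  a + b * (N%:R * x) + c * (N%:R * x * (1 - x) + N%:R ^+ 2 * x ^+ 2).
Proof.
elim: N a b c => [|N IH] a b c /=.
  by rewrite hornerC expr0n /= !(mul0r, mulr0, addr0).
have h1 : (1 - 'X : {poly R}).[x] = 1 - x by rewrite !hornerE.
rewrite hornerD 2!hornerM hornerX h1 IH.
have -> : (fun k => a + b * k%:R + c * k%:R ^+ 2) \o succn =
    fun k => (a + b + c) + (b + 2 * c) * k%:R + c * k%:R ^+ 2.
  by apply/funext => k /=; rewrite -natr1; ring.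
by rewrite IH -[N.+1%:R]natr1; ring.
Qed.

(** Uniform continuity and boundedness, packed in the form in which
    Chebyshev's inequality uses them. *)
Lemma quadratic_modulus f e : continuous f -> 0 < e ->
  exists2 C, 0 <= C & forall x y, 0 <= x <= 1 -> 0 <= y <= 1 ->
    `|f x - f y| <= e + C * (x - y) ^+ 2.
Proof.
move=> cf e0.
have cabs : {within `[0, 1], continuous (fun x : R => `|f x|)}.
  apply: continuous_subspaceT => x.
  by apply: (continuous_comp (cf x)); exact: norm_continuous.
have [c _ hM] := EVT_max ler01 cabs; set M := `|f c| in hM.
have M0 : 0 <= M by rewrite normr_ge0.
have [d d0 hd] : exists2 d, 0 < d & forall x, 0 <= x <= 1 ->
    forall y, `|x - y| <= d -> `|f x - f y| <= e.
  have /compact_near_coveringP/(_ _ (0^'+)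
      (fun (d : R) x => forall y, `|x - y| <= d -> `|f x - f y| <= e)) :=
    @segment_compact R 0 1.
  case.
    move=> x _.
    have e20 : 0 < e / 2 by rewrite divr_gt0.
    have /cvgrPdist_le/(_ _ e20)/nbhs_ballP[r /= r0 hr] := cf x.
    have r20 : 0 < r / 2 by rewrite divr_gt0.
    exists (ball x (r / 2), [set d | d < r / 2]) => /=.
      by split; [exact: nbhsx_ballx|exact: nbhs_right_lt].
    move=> [x' d] /= [xx' dr] y x'y.
    have h1 : `|f x - f x'| <= e / 2.
      by apply: hr; apply: le_ball xx'; rewrite ler_pdivrMr// ler_pMr// ler1n.
    have h2 : `|f x - f y| <= e / 2.
      apply: hr; rewrite /ball/=; rewrite /ball/= in xx'.
      rewrite -(subrK x' x) -addrA (le_lt_trans (ler_normD _ _))//.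
      by rewrite [ltRHS](splitr r) ltrD// (le_lt_trans x'y).
    rewrite -[f x'](subrK (f x)) -addrA (le_trans (ler_normD _ _))//.
    by rewrite distrC [leRHS](splitr e) lerD.
  move=> r /= r0 hr; exists (r / 2); first by rewrite divr_gt0.
  move=> x x01; apply: hr; rewrite /= ?divr_gt0//.
    rewrite sub0r normrN gtr0_norm ?divr_gt0//.
    by rewrite ltr_pdivrMr// ltr_pMr// ltr1n.
(* Beyond distance [d], the crude bound [2 M] is absorbed by the square. *)
exists (2 * M / d ^+ 2).
  by rewrite divr_ge0 ?mulr_ge0 ?exprn_ge0// ltW.
move=> x y x01 y01; have [xyd|dxy] := leP `|x - y| d.
  rewrite (le_trans (hd x x01 y xyd))// lerDl mulr_ge0 ?sqr_ge0//.
  by rewrite divr_ge0 ?mulr_ge0 ?exprn_ge0// ltW.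
rewrite ler_wpDl ?(ltW e0)// (le_trans (ler_normB _ _))//.
have h1 : `|f x| <= M by apply: hM; rewrite in_itv.
have h2 : `|f y| <= M by apply: hM; rewrite in_itv.
apply: (le_trans (lerD h1 h2)).
have dd0 : 0 < d ^+ 2 by rewrite exprn_gt0.
have h3 : d ^+ 2 <= (x - y) ^+ 2.
  rewrite -[leRHS]real_normK ?num_real//.
  by rewrite ler_pXn2r ?nnegrE ?normr_ge0// ltW.
have -> : M + M = 2 * M / d ^+ 2 * d ^+ 2 by field; rewrite gt_eqF.
by apply: ler_wpM2l => //; apply: divr_ge0; [exact: mulr_ge0|exact: ltW].
Qed.

(** Bernstein's proof: the bound of [quadratic_modulus] is preserved under the
    binomial mean, where [(x - k / N)^2] has mean [x (1 - x) / N]. *)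
Lemma weierstrass01 f e : continuous f -> 0 < e ->
  exists p : {poly R}, forall x, 0 <= x <= 1 -> `|f x - p.[x]| <= e.
Proof.
move=> cf e0; have e20 : 0 < e / 2 by rewrite divr_gt0.
have [C C0 hC] := quadratic_modulus cf e20.
pose N := (Num.bound (C / (e / 2))).+1.
have N0 : 0 < N%:R :> R by rewrite ltr0n.
exists (bernstein N (fun k => f (k%:R / N%:R))) => x x01.
have /andP[x0 x1] := x01.
(* The polynomial [f x + s (e/2 + C (x - k/N)^2)] in [k], expanded; the upper
   and lower bounds are [s = 1] and [s = -1]. *)
have key s : (bernstein N (fun k => (f x + s * (e / 2 + C * x ^+ 2)) +
      (- 2 * s * C * x / N%:R) * k%:R + (s * C / N%:R ^+ 2) * k%:R ^+ 2)).[x]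
    = f x + s * (e / 2 + C * (x * (1 - x)) / N%:R).
  rewrite bernstein_quadratic; field; by rewrite gt_eqF.
have bnd k : (k <= N)%N -> `|f x - f (k%:R / N%:R)| <=
    e / 2 + C * (x - k%:R / N%:R) ^+ 2.
  move=> kN; apply: hC => //; rewrite divr_ge0//= ler_pdivrMr// mul1r.
  by rewrite ler_nat.
have o_sqr : C * (x * (1 - x)) / N%:R <= e / 2.
  rewrite ler_pdivrMr// (@le_trans _ _ C)//.
    by rewrite ler_piMr//; nra.
  rewrite mulrC -ler_pdivrMr// (le_trans (ltW (archi_boundP _)))//.
    by rewrite divr_ge0// ltW.
  by rewrite ler_nat.
have up : (bernstein N (fun k => f (k%:R / N%:R))).[x] <=
    f x + 1 * (e / 2 + C * (x * (1 - x)) / N%:R).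
  rewrite -key; apply: bernstein_le => // k /bnd.
  rewrite distrC ler_norml => /andP[_]; rewrite lerBlDl => /le_trans; apply.
  by rewrite le_eqVlt; apply/orP; left; apply/eqP; field; rewrite gt_eqF.
have lo : f x + (- 1) * (e / 2 + C * (x * (1 - x)) / N%:R) <=
    (bernstein N (fun k => f (k%:R / N%:R))).[x].
  rewrite -key; apply: bernstein_le => // k /bnd.
  rewrite ler_norml => /andP[_]; rewrite lerBlDl -lerBlDr; apply: le_trans.
  by rewrite le_eqVlt; apply/orP; left; apply/eqP; field; rewrite gt_eqF.
by rewrite ler_norml; apply/andP; split; lra.
Qed.

Lemma weierstrass f (a b e : R) : a < b -> continuous f -> 0 < e ->
  exists p : {poly R}, forall x, a <= x <= b -> `|f x - p.[x]| <= e.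
Proof.
move=> ab cf e0; have ba : 0 < b - a by rewrite subr_gt0.
have cg : continuous (fun u => f (a + (b - a) * u)).
  move=> u; apply: continuous_comp; last exact: cf.
  by apply: cvgD; [exact: cvg_cst|exact: mulrl_continuous].
have [p hp] := weierstrass01 cg e0.
exists (p \Po ((b - a)^-1 *: ('X - a%:P))) => x /andP[ax xb].
rewrite horner_comp !hornerE.
have E : a + (b - a) * ((b - a)^-1 * (x - a)) = x.
  by field; rewrite gt_eqF.
have := hp ((b - a)^-1 * (x - a)); rewrite E; apply.
rewrite mulr_ge0 ?invr_ge0 ?subr_ge0 ?(ltW ba)//=; last exact: ltW.
by rewrite mulrC ler_pdivrMr// mul1r lerB.
Qed.

End weierstrass.

(** * The symbol of the fractional Laplacian *)

Section symbol.
Context {R : realType}.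
Local Notation plane := (measurableTypeR R * measurableTypeR R)%type.
Variables (alpha : R).
Hypothesis alpha0 : 0 < alpha.

(** The symbol of the five-point discrete Laplacian. *)
Definition laplacian (th : R * R) : R :=
  4 * sin (th.1 / 2) ^+ 2 + 4 * sin (th.2 / 2) ^+ 2.

Lemma laplacian_ge0 th : 0 <= laplacian th.
Proof. by rewrite addr_ge0// mulr_ge0// sqr_ge0. Qed.

Lemma laplacian_le8 th : laplacian th <= 8.
Proof.
have s1 (x : R) : sin x ^+ 2 <= 1 by rewrite sin2cos2 gerBl sqr_ge0.
by have := s1 (th.1 / 2); have := s1 (th.2 / 2); rewrite /laplacian; lra.
Qed.

Lemma measurable_laplacian :
  measurable_fun (setT : set plane) (laplacian : plane -> R).
Proof.
have ms : measurable_fun setT (fun x : R => 4 * sin (x / 2) ^+ 2).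
  apply: measurable_funM; first exact: measurable_cst.
  apply: measurable_funX; apply: continuous_measurable_fun => x.
  by apply: continuous_comp; [exact: mulrr_continuous|exact: continuous_sin].
by apply: measurable_funD; apply: (measurableT_comp ms);
  [exact: measurable_fst|exact: measurable_snd].
Qed.

Lemma trig_polynomial_laplacian : trig_polynomial (fun th => (laplacian th)%:C).
Proof.
exists [:: (4, (0, 0)); (-1, (1, 0)); (-1, (-1, 0));
           (-1, (0, 1)); (-1, (0, -1))].
move=> th; rewrite !big_cons big_nil /=.
have half (x : R) : 4 * sin (x / 2) ^+ 2 = 2 - 2 * cos x.
  rewrite {2}(_ : x = (x / 2) *+ 2); last by rewrite -mulr_natr mulfVK.
  by rewrite cos_mulr2n sin2cos2; ring.
rewrite /laplacian !half !mul0r !(mul1r, mulN1r, add0r, addr0, mulNr).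
rewrite expi0 mulr1.
rewrite /expi !cosN !sinN -(rmorph_nat (real_complex R) 4) /=.
by simpc; congr (_ +i* _); ring.
Qed.

Lemma trig_polynomial_horner (p : {poly R}) :
  trig_polynomial (fun th => (p.[laplacian th])%:C).
Proof.
elim/poly_ind: p => [|p c IH].
  have -> : (fun th : R * R => (0.[laplacian th])%:C) = fun=> 0.
    by apply/funext => th; rewrite horner0.
  exact: trig_polynomial_cst.
have -> : (fun th => ((p * 'X + c%:P).[laplacian th])%:C) =
          fun th => (p.[laplacian th])%:C * (laplacian th)%:C + c%:C.
  by apply/funext => th; rewrite !hornerE rmorphD rmorphM.
exact: (trig_polynomialD (trig_polynomialM IH trig_polynomial_laplacian)
  (trig_polynomial_cst _)).
Qed.

(** The truncation at zero is there because the power function jumps at [0] from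
    the left, negative numbers having the power [1]. *)
Lemma continuous_powR_pos (a : R) : 0 < a ->
  continuous (fun x : R => (Num.max 0 x) `^ a).
Proof.
move=> a0 x; have [x0|x0|x0] := ltgtP x 0.
- rewrite /continuous_at max_l ?(ltW x0)// powR0 ?gt_eqF//.
  apply: cvg_near_cst; near=> y.
  rewrite max_l ?powR0 ?gt_eqF//; apply: ltW.
  by near: y; exact: lt_nbhsl.
- rewrite /continuous_at max_r ?(ltW x0)//.
  have c : {for x, continuous (fun y : R => y `^ a)}.
    apply: differentiable_continuous; apply/derivable1_diffP.
    by apply: derivable_powR; rewrite in_itv/= x0.
  apply: cvg_trans c; apply: near_eq_cvg; near=> y.
  rewrite max_r//; apply: ltW.
  by near: y; exact: lt_nbhsr.
- rewrite /continuous_at x0 maxxx powR0 ?gt_eqF//; apply/cvgrPdist_le => e e0.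
  apply/nbhs_ballP; exists (e `^ a^-1) => /=; first exact: powR_gt0.
  move=> y; rewrite /ball/= sub0r normrN => ye.
  rewrite sub0r normrN ger0_norm ?powR_ge0//.
  have -> : e = (e `^ a^-1) `^ a.
    by rewrite -powRrM mulVf ?gt_eqF// powRr1// ltW.
  apply: ge0_ler_powR; rewrite ?nnegrE ?powR_ge0 ?(ltW a0) ?le_max ?lexx//.
  by rewrite ge_max powR_ge0/= (le_trans (ler_norm _))// ltW.
Unshelve. all: by end_near. Qed.

Lemma t_alpha_ge0 th : 0 <= t_alpha alpha th.
Proof. by rewrite ler0c powR_ge0. Qed.

Lemma cbmeas_t_alpha : cbmeas (t_alpha alpha).
Proof.
split; last exact: bmeas_cst.
split; first exact: (measurableT_comp (measurable_powR _) measurable_laplacian).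
exists (8 `^ (alpha / 2)) => th /=; rewrite ger0_norm ?powR_ge0//.
apply: ge0_ler_powR; rewrite ?nnegrE ?laplacian_ge0 ?divr_ge0 ?(ltW alpha0)//.
exact: laplacian_le8.
Qed.

(** [t_alpha] is a continuous function of [laplacian], so polynomials in
    [laplacian] approximate it uniformly. *)
Lemma approximable_t_alpha : approximable (t_alpha alpha).
Proof.
split; first exact: cbmeas_t_alpha.
  by move=> x; rewrite conj_Creal ?ger0_real ?t_alpha_ge0.
move=> e e0.
have a20 : 0 < alpha / 2 by rewrite divr_gt0.
have [p hp] := weierstrass (ltr0n R 8) (continuous_powR_pos a20) e0.
exists (fun th => (p.[laplacian th])%:C).
split; first exact: trig_polynomial_horner.
  by move=> th; exact: conjc_real.
move=> th; rewrite -rmorphB/= normc_def/= expr0n/= addr0 sqrtr_sqr lecR.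
have := hp (laplacian th); rewrite max_r ?laplacian_ge0//; apply.
by rewrite laplacian_le8.
Qed.

End symbol.

(** * Eigenvalue distribution from moments *)

Section spectrum.
Context {R : realType}.
Implicit Types (n k : nat).

Lemma is_trig_mulmx n (A B : 'M[R[i]]_n) : is_trig_mx A -> is_trig_mx B ->
  is_trig_mx (A *m B) /\ forall i, (A *m B) i i = A i i * B i i.
Proof.
move=> /is_trig_mxP tA /is_trig_mxP tB; split.
  apply/is_trig_mxP => i j ij; rewrite mxE big1// => l _.
  have [il|li] := ltnP i l; first by rewrite tA ?mul0r.
  by rewrite tB ?mulr0// (leq_ltn_trans li).
move=> i; rewrite mxE (bigD1 i)//= big1 ?addr0// => l.
rewrite -val_eqE neq_ltn => /orP[li|il]; first by rewrite tB ?mulr0.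
by rewrite tA ?mul0r.
Qed.

Lemma char_poly_eigenvalues n (A : 'M[R[i]]_n) :
  char_poly A = \prod_(z <- eigenvalues A) ('X - z%:P).
Proof.
rewrite /eigenvalues; case: closed_field_poly_normal => s /= {1}->.
by rewrite (monicP (char_poly_monic A)) scale1r.
Qed.

Lemma size_eigenvalues n (A : 'M[R[i]]_n) : size (eigenvalues A) = n.
Proof.
have := size_char_poly A; rewrite char_poly_eigenvalues.
by rewrite size_prod_XsubC => -[].
Qed.

Lemma eigenvaluesP n (A : 'M[R[i]]_n) z : z \in eigenvalues A -> eigenvalue A z.
Proof.
by rewrite eigenvalue_root_char char_poly_eigenvalues root_prod_XsubC.
Qed.

(** By Schur's theorem [A] is unitarily similar to a triangular matrix, whose
    diagonal lists the eigenvalues; powers act entrywise on that diagonal. *)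
Lemma trace_pow n (A : 'M[R[i]]_n) k :
  \sum_(z <- eigenvalues A) z ^+ k = \tr (A ^+ k).
Proof.
have [n0|n0] := posnP n.
  rewrite (size0nil (etrans (size_eigenvalues A) n0)) big_nil.
  by rewrite /mxtrace big1// => i; have := ltn_ord i; rewrite {2}n0.
have [P Pu tri_B] := Schur A n0.
rewrite /similar_to/= conjymx// in tri_B.
have PP : P^t* *m P = 1%:M by rewrite -invmx_unitary// mulVmx// unitarymx_unit.
set B := P *m A *m P^t* in tri_B.
have BkE j : B ^+ j = P *m (A ^+ j) *m P^t*.
  elim: j => [|j IH]; first by rewrite !expr0 mulmx1; exact/esym/unitarymxP.
  rewrite exprS IH exprS /B -[LHS]/(_ *m _) !mulmxA.
  by rewrite -[P *m A *m P^t* *m P]mulmxA PP mulmx1.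
have tri_pow j : is_trig_mx (B ^+ j) /\ forall i, (B ^+ j) i i = B i i ^+ j.
  elim: j => [|j [IH1 IH2]].
    split; first exact: scalar_mx_is_trig.
    by move=> i; rewrite !expr0 mxE eqxx.
  have [h1 h2] := is_trig_mulmx tri_B IH1.
  by rewrite exprS; split => // i; rewrite exprS -IH2; exact: h2.
have chB : char_poly A = char_poly B.
  rewrite /char_poly.
  have -> : char_poly_mx B =
      map_mx polyC P *m char_poly_mx A *m map_mx polyC (P^t*).
    rewrite /char_poly_mx /B mulmxBr mulmxBl !map_mxM/=; congr (_ - _).
    rewrite mul_mx_scalar -scalemxAl -map_mxM.
    by rewrite (unitarymxP _)// map_scalar_mx/= scalemx1.
  rewrite !det_mulmx mulrAC -det_mulmx -map_mxM.
  by rewrite (unitarymxP _)// map_scalar_mx det1 mul1r.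
have perm : perm_eq (eigenvalues A) [seq B i i | i : 'I_n].
  apply: prod_XsubC_eq; rewrite -char_poly_eigenvalues chB char_poly_trig//.
  by rewrite big_map big_enum.
rewrite (perm_big _ perm) big_map big_enum/=.
transitivity (\tr (B ^+ k)).
  by apply: eq_bigr => i _; rewrite (tri_pow k).2.
by rewrite BkE mxtrace_mulC mulmxA PP mul1mx.
Qed.

End spectrum.

Lemma continuous_hornerC (K : numFieldType) (p : {poly K}) :
  continuous (fun z : K^o => p.[z] : K^o).
Proof.
elim/poly_ind: p => [|q c IH].
  have -> : (fun z : K^o => (0 : {poly K}).[z] : K^o) = cst 0.
    by apply/funext => z; rewrite horner0.
  exact: cst_continuous.
have -> : (fun z : K^o => (q * 'X + c%:P).[z] : K^o) =
    fun z : K^o => (q.[z] : K^o) * z + c.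
  by apply/funext => z; rewrite !hornerE.
move=> z.
apply: (@continuousD K K^o K^o
    (fun z : K^o => (q.[z] : K^o) * z : K^o) (cst c));
  last exact: cst_continuous.
by apply: (@continuousM K K^o (fun z : K^o => q.[z] : K) id); [exact: IH|].
Qed.

Section strip.
Context {R : realType}.
Local Notation plane := (measurableTypeR R * measurableTypeR R)%type.
Implicit Types (F : R[i]^o -> R[i]^o) (e C : R).

Lemma pos_real_complex (e : R[i]) : 0 < e -> exists2 r : R, 0 < r & e = r%:C.
Proof.
move=> e0; exists (complex.Re e); last by rewrite RRe_real// gtr0_real.
by move: e0; rewrite ltcE => /andP[].
Qed.

Lemma continuous_real_complex : continuous (fun x : R => x%:C : R[i]^o).
Proof.
move=> x; apply/cvgrPdist_le => _ /pos_real_complex[r r0 ->].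
apply/nbhs_ballP; exists r => //= y; rewrite /ball/= => /ltW xy.
by rewrite -rmorphB/= normc_def/= expr0n/= addr0 sqrtr_sqr lecR.
Qed.

Lemma continuous_Re : continuous (fun z : R[i]^o => complex.Re z).
Proof.
move=> z; apply/(@cvgrPdist_le _ R _ (nbhs z) _ _ (complex.Re z)) => r r0.
apply/nbhs_ballP; exists r%:C => /=; first by rewrite ltcR.
move=> y; rewrite /ball/= => /ltW zy.
rewrite -lecR (le_trans _ zy)// (_ : _ - _ = complex.Re (z - y)); last first.
  by case: (z) (y) => [? ?] [].
exact: normc_ge_Re.
Qed.

Lemma continuous_Im : continuous (fun z : R[i]^o => complex.Im z).
Proof.
move=> z; apply/(@cvgrPdist_le _ R _ (nbhs z) _ _ (complex.Im z)) => r r0.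
apply/nbhs_ballP; exists r%:C => /=; first by rewrite ltcR.
move=> y; rewrite /ball/= => /ltW zy.
rewrite -lecR (le_trans _ zy)// (_ : _ - _ = complex.Im (z - y)); last first.
  by case: (z) (y) => [? ?] [].
exact: normc_ge_Im.
Qed.

(** On the real segment, approximate the real and imaginary parts of [F] by
    real polynomials; the error extends to a thin strip by compactness of
    the segment. *)
Lemma strip_approx F C e : 0 < C -> 0 < e -> continuous F ->
  exists (p : {poly R[i]}) (d : R), 0 < d /\ forall z : R[i],
    `|z| <= C%:C -> `|complex.Im z| <= d -> `|F z - p.[z]| <= e%:C.
Proof.
move=> C0 e0 cF.
have cFR : continuous (fun x : R => F x%:C).
  move=> x.
  exact: (@continuous_comp _ _ _ (fun u : R => u%:C : R[i]^o) F x
    (@continuous_real_complex x) (cF _)).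
have cRe : continuous (fun x : R => complex.Re (F x%:C)).
  move=> x.
  exact: (@continuous_comp _ _ _ (fun u : R => F u%:C) _ x (cFR x)
    (@continuous_Re _)).
have cIm : continuous (fun x : R => complex.Im (F x%:C)).
  move=> x.
  exact: (@continuous_comp _ _ _ (fun u : R => F u%:C) _ x (cFR x)
    (@continuous_Im _)).
have CC : - C < C by rewrite gtrN.
have e40 : 0 < e / 4 by rewrite divr_gt0.
have [p1 hp1] := weierstrass CC cRe e40.
have [p2 hp2] := weierstrass CC cIm e40.
pose p := map_poly (real_complex R) p1 + 'i%C *: map_poly (real_complex R) p2.
have hp (x : R) : - C <= x <= C -> `|F x%:C - p.[x%:C]| <= (e / 2)%:C.
  move=> xC; rewrite (le_trans (normc_le_ReIm _))// lecR.
  rewrite [e in leRHS]splitr mulrDl.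
  have -> : e / 2 / 2 = e / 4 by field.
  have -> : p.[x%:C] = p1.[x] +i* p2.[x].
    by rewrite hornerD hornerZ !horner_map/=; simpc.
  move: (hp1 x xC) (hp2 x xC); case: (F x%:C) => a b /= h1 h2.
  exact: lerD.
pose G (z : R[i]^o) : R[i]^o := F z - p.[z].
have cG : continuous G.
  move=> z; exact: (@continuousB _ R[i]^o R[i]^o F (fun z => p.[z]) z (cF z)
    (@continuous_hornerC R[i] p z)).
(* A neighbourhood of each real point, times a range of imaginary parts. *)
have /compact_near_coveringP/(_ _ (nbhs (0 : R))
    (fun (y : R) x => `|G (x +i* y)| <= e%:C)) := @segment_compact R (- C) C.
case.
  move=> x xC.
  have e20 : 0 < (e / 2)%:C by rewrite ltcR divr_gt0.
  have /cvgrPdist_le/(_ _ e20)/nbhs_ballP[_ /= /pos_real_complex[r r0 ->] hr] :=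
    cG x%:C.
  have r20 : 0 < r / 2 by rewrite divr_gt0.
  exists (ball x (r / 2), ball 0 (r / 2)) => /=.
    by split; exact: nbhsx_ballx.
  move=> [x' y] /= [xx' yr].
  have h1 : `|G x%:C - G (x' +i* y)| <= (e / 2)%:C.
    apply: hr; rewrite /ball/=.
    rewrite (le_lt_trans (normc_le_ReIm _))// ltcR/= sub0r normrN.
    move: xx' yr; rewrite /ball/= sub0r normrN => xx' yr.
    by rewrite [ltRHS]splitr ltrD.
  have h2 : `|G x%:C| <= (e / 2)%:C by apply: hp; move: xC; rewrite /= in_itv.
  rewrite -[G _](subKr (G x%:C)) (le_trans (ler_normB _ _))//.
  by rewrite [e in leRHS]splitr rmorphD/= lerD.
move=> r /= r0 hr; exists p, (r / 2); split; first by rewrite divr_gt0.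
move=> [a b] zC zb.
have := hr b; rewrite /ball_/= sub0r normrN => /(_ _ a); apply.
  by rewrite (le_lt_trans zb)// ltr_pdivrMr// ltr_pMr// ltr1n.
rewrite /= in_itv/= -ler_norml -lecR (le_trans _ zC)//.
exact: (normc_ge_Re (a +i* b)).
Qed.

(** A polynomial approximation of [F] on the range of [g] gives boundedness. *)
Lemma cbmeas_comp F (g : plane -> R[i]) : continuous F -> cbmeas g -> realv g ->
  cbmeas (fun x => F (g x)).
Proof.
move=> cF bg rg.
have [M M0 gM] := cbmeas_bounded bg.
have gE x : g x = (complex.Re (g x))%:C.
  by rewrite RRe_real//; apply/CrealP; exact: rg.
have [p [d [d0 hp]]] := strip_approx M0 ltr01 cF.
have bp : cbmeas (fun x => p.[g x]).
  elim/poly_ind: (p) => [|q c IH].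
    rewrite (_ : (fun x => _) = fun=> 0); first exact: cbmeas_cst.
    by apply/funext => x; rewrite horner0.
  rewrite (_ : (fun x => _) = fun x => q.[g x] * g x + c); last first.
    by apply/funext => x; rewrite !hornerE.
  by apply: cbmeasD; [exact: cbmeasM|exact: cbmeas_cst].
have [N N0 pN] := cbmeas_bounded bp.
have FN x : `|F (g x)| <= (N + 1)%:C.
  rewrite -[F _](subrK p.[g x]) (le_trans (ler_normD _ _))//.
  rewrite addrC rmorphD/= lerD// hp// gE/=.
  by rewrite normr0 ltW.
have cFR : continuous (fun x : R => F x%:C).
  move=> x.
  exact: (@continuous_comp _ _ _ (fun u : R => u%:C : R[i]^o) F x
    (@continuous_real_complex x) (cF _)).
have mRe : measurable_fun setT (fun x => complex.Re (g x)) by case: bg => -[].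
split; split.
- rewrite (_ : (fun x => _) = (fun u : R => complex.Re (F u%:C)) \o
      (fun x => complex.Re (g x))); last first.
    by apply/funext => x /=; rewrite {1}gE.
  apply: measurableT_comp => //; apply: continuous_measurable_fun => x.
  exact: (@continuous_comp _ _ _ (fun u : R => F u%:C) _ x (cFR x)
    (@continuous_Re _)).
- exists (N + 1) => x; rewrite -lecR (le_trans _ (FN x))//.
  exact: normc_ge_Re.
- rewrite (_ : (fun x => _) = (fun u : R => complex.Im (F u%:C)) \o
      (fun x => complex.Re (g x))); last first.
    by apply/funext => x /=; rewrite {1}gE.
  apply: measurableT_comp => //; apply: continuous_measurable_fun => x.
  exact: (@continuous_comp _ _ _ (fun u : R => F u%:C) _ x (cFR x)
    (@continuous_Im _)).
- exists (N + 1) => x; rewrite -lecR (le_trans _ (FN x))//.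
  exact: normc_ge_Im.
Qed.

End strip.

Section limit.
Context {R : realType}.
Local Notation plane := (measurableTypeR R * measurableTypeR R)%type.
Local Notation mxseq := (forall n : nat, 'M[R[i]]_(n * n)).
Implicit Types (F : R[i]^o -> R[i]^o) (e C : R) (a : nat -> R[i]) (X : mxseq).

Definition o_sqr a := forall e, 0 < e ->
  exists N, forall n, (N <= n)%N -> `|a n| <= e%:C * (n * n)%:R.

Lemma o_sqrD a b : o_sqr a -> o_sqr b -> o_sqr (fun n => a n + b n).
Proof.
move=> ha hb e e0; have e20 : 0 < e / 2 by rewrite divr_gt0.
have [N hN] := ha _ e20; have [M hM] := hb _ e20.
exists (maxn N M) => n; rewrite geq_max => /andP[/hN h1 /hM h2].
rewrite (le_trans (ler_normD _ _))// (le_trans (lerD h1 h2))//.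
by rewrite -mulrDl -rmorphD/= -splitr.
Qed.

Lemma o_sqrZ c a : o_sqr a -> o_sqr (fun n => c * a n).
Proof.
move=> ha e e0; have m0 : 0 < modC c + 1.
  by rewrite ltr_wpDl// -lecR modCE normr_ge0.
have d0 : 0 < e / (modC c + 1) by rewrite divr_gt0.
have [N hN] := ha _ d0; exists N => n /hN h; rewrite normrM.
apply: (@le_trans _ _ ((modC c + 1)%:C * ((e / (modC c + 1))%:C * (n * n)%:R))).
  by apply: ler_pM => //; rewrite -modCE lecR lerDl.
rewrite mulrA -rmorphM/= (_ : _ * (e / _) = e)//.
by field; rewrite gt_eqF.
Qed.

Lemma o_sqr_sum m (b : nat -> nat -> R[i]) :
  (forall i, o_sqr (b i)) -> o_sqr (fun n => \sum_(i < m) b i n).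
Proof.
move=> hb; elim: m => [|m IH] e e0.
  by exists 0%N => n _; rewrite big_ord0 normr0 mulr_ge0// ler0c ltW.
have [N hN] := o_sqrD IH (hb m) e0.
by exists N => n /hN; rewrite big_ord_recr.
Qed.

Lemma realv_Im (g : R * R -> R[i]) x : realv g -> complex.Im (g x) = 0.
Proof.
by move=> rg; apply: complexI; rewrite RIm_real//; apply/CrealP; exact: rg.
Qed.

(** Bounded spectra that approach the real line uniformly lie in a thin strip,
    where polynomials are dense among the test functions; so the moments
    determine the limit. *)
Lemma eigenvalues_cvg X (g : R * R -> R[i]) C F :
  0 < C -> approximable g -> (forall x, `|g x| <= C%:C) ->
  (forall k, o_sqr (fun n => \tr (X n ^+ k) -
                             (n * n)%:R * tavg (fun x => g x ^+ k))) ->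
  (forall n z, eigenvalue (X n) z -> `|z| <= C%:C) ->
  (forall e, 0 < e -> exists N, forall n, (N <= n)%N ->
     forall z, eigenvalue (X n) z -> `|complex.Im z| <= e) ->
  continuous F ->
  ((n * n)%:R^-1 * \sum_(z <- eigenvalues (X n)) F z : R[i]^o)
    @[n --> \oo] --> (tavg (fun x => F (g x)) : R[i]^o).
Proof.
move=> C0 [bg rg _] gC mom bnd imz cF.
apply/cvgrPdist_le => _ /pos_real_complex[e e0 ->].
have e4 : 0 < e / 4 by rewrite divr_gt0.
have [p [d [d0 hp]]] := strip_approx C0 e4 cF.
have [N1 hN1] := imz _ d0.
have bgk k : cbmeas (fun x => g x ^+ k).
  elim: k => [|k IH]; first exact: cbmeas_cst.
  by under eq_fun do rewrite exprS; exact: cbmeasM.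
have pE x : p.[g x] = \sum_(i < size p) p`_i * g x ^+ i by rewrite horner_coef.
have bp : cbmeas (fun x => p.[g x]).
  rewrite (_ : (fun x => _) = fun x => \sum_(i < size p) p`_i * g x ^+ i).
    by apply: cbmeas_sum => i; apply: cbmeasM; [exact: cbmeas_cst|exact: bgk].
  by apply/funext => x; rewrite pE.
have tp : tavg (fun x => p.[g x]) =
    \sum_(i < size p) p`_i * tavg (fun x => g x ^+ i).
  transitivity (tavg (fun x => \sum_(i < size p) p`_i * g x ^+ i)).
    by congr tavg; apply/funext => x; rewrite pE.
  rewrite tavg_sum; last first.
    by move=> i; apply: cbmeasM; [exact: cbmeas_cst|exact: bgk].
  by apply: eq_bigr => i _; rewrite tavgZ.
have [N2 hN2] := o_sqr_sum (size p) (fun i => o_sqrZ p`_i (mom i)) e4.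
have bF : cbmeas (fun x => F (g x)) by exact: cbmeas_comp.
near=> n.
have n0 : (0 < n * n)%N by rewrite muln_gt0 andbb; near: n; exists 1%N.
have nn0 : (n * n)%:R != 0 :> R[i] by rewrite pnatr_eq0 -lt0n.
have nn1 : 0 < (n * n)%:R :> R[i] by rewrite ltr0n.
have h1 : `|\sum_(z <- eigenvalues (X n)) F z -
            \sum_(z <- eigenvalues (X n)) p.[z]| <= (e / 4)%:C * (n * n)%:R.
  rewrite -sumrB (le_trans (ler_norm_sum _ _ _))//.
  rewrite mulr_natr -[X in _ *+ X](size_eigenvalues (X n)) -sum1_size.
  rewrite -sumrMnr big_seq [leRHS]big_seq; apply: ler_sum => z zX.
  have zE := eigenvaluesP zX.
  rewrite mulr1n; apply: hp; first exact: bnd zE.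
  by apply: hN1 zE; near: n; exists N1.
have h2 : `|\sum_(z <- eigenvalues (X n)) p.[z] -
            (n * n)%:R * tavg (fun x => p.[g x])| <= (e / 4)%:C * (n * n)%:R.
  have -> : \sum_(z <- eigenvalues (X n)) p.[z] -
      (n * n)%:R * tavg (fun x => p.[g x]) =
      \sum_(i < size p) p`_i * (\tr (X n ^+ i) -
                             (n * n)%:R * tavg (fun x => g x ^+ i)).
    rewrite (eq_bigr (fun z => \sum_(i < size p) p`_i * z ^+ i)); last first.
      by move=> z _; rewrite horner_coef.
    rewrite exchange_big tp mulr_sumr -sumrB; apply: eq_bigr => i _.
    by rewrite -mulr_sumr trace_pow mulrBr mulrCA.
  by apply: hN2; near: n; exists N2.
have h3 : `|tavg (fun x => p.[g x]) - tavg (fun x => F (g x))| <=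
    (e / 2)%:C.
  rewrite -mulN1r -tavgZ// -tavgD//; last first.
    by apply: cbmeasM => //; exact: cbmeas_cst.
  have -> : e / 2 = (e / 4) *+ 2 by rewrite -mulr_natr; field.
  apply: tavg_norm_le.
    by apply: cbmeasD => //; apply: cbmeasM => //; exact: cbmeas_cst.
  move=> x; rewrite mulN1r distrC; apply: hp; first exact: gC.
  by rewrite realv_Im// normr0 ltW.
rewrite distrC.
have -> : e%:C = (e / 4)%:C + (e / 4)%:C + (e / 2)%:C :> R[i].
  by rewrite -!rmorphD/=; congr _%:C; field.
set S := \sum_(z <- _) F z in h1 *; set P := \sum_(z <- _) p.[z] in h1 h2.
have -> : (n * n)%:R^-1 * S - tavg (fun x => F (g x)) =
  (n * n)%:R^-1 * (S - P) +
  (n * n)%:R^-1 * (P - (n * n)%:R * tavg (fun x => p.[g x])) +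
  (tavg (fun x => p.[g x]) - tavg (fun x => F (g x))).
  move: nn0; move: ((n * n)%:R) => k k0.
  by field.
rewrite (le_trans (ler_normD _ _))// lerD//.
rewrite (le_trans (ler_normD _ _))// lerD//.
- by rewrite normrM normfV (gtr0_norm nn1) mulrC ler_pdivrMr.
- by rewrite normrM normfV (gtr0_norm nn1) mulrC ler_pdivrMr.
Unshelve. all: by end_near. Qed.

End limit.

(** * The perturbed Toeplitz sequence *)

Section perturbation.
Context {R : realType}.
Local Notation plane := (measurableTypeR R * measurableTypeR R)%type.
Variables (alpha : R) (mu : R * R -> R[i]).
Hypothesis alpha1 : 1 < alpha.
Hypothesis hmu : bounded_samples mu.

Let alpha0 : 0 < alpha. Proof. exact: lt_trans alpha1. Qed.

Local Notation A := (perturbed alpha mu).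

Definition pot_mx n : 'M[R[i]]_(n * n) := (step n `^ alpha)%:C *: D_mx n mu.

Definition pot_diag n : 'rV[R[i]]_(n * n) := (step n `^ alpha)%:C *:
  \row_k mu ((lex1 k)%:R * step n, (lex2 k)%:R * step n).

Lemma pot_mxE n : pot_mx n = diag_mx (pot_diag n).
Proof. by rewrite /pot_mx /pot_diag /D_mx /sampling_mx linearZ. Qed.

Lemma step_gt0 n : 0 < @step R n.
Proof. by rewrite invr_gt0 ltr0n. Qed.

Lemma step_le1 n : @step R n <= 1.
Proof. by rewrite invf_le1 ?ltr0n// ler1n. Qed.

Lemma step_small e : 0 < e -> exists N, forall n, (N <= n)%N -> @step R n <= e.
Proof.
move=> e0; exists (Num.bound e^-1) => n hn.
rewrite /step invf_ple ?posrE ?ltr0n//.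
rewrite (le_trans (ltW (archi_boundP _))) ?invr_ge0 ?(ltW e0)//.
by rewrite ler_nat (leq_trans hn).
Qed.

(** Since [alpha > 1] and [h <= 1], the factor [h^alpha] is at most [h]. *)
Lemma pot_diag_le :
  exists2 M, 0 < M & forall n k, `|pot_diag n 0 k| <= (step n * M)%:C.
Proof.
have [M hM] := hmu; exists (`|M| + 1) => [|n k]; first by rewrite ltr_wpDl.
have k1 : (0 < n)%N by case: n k => // -[].
rewrite !mxE normrM rmorphM/=; apply: ler_pM => //.
  rewrite ger0_norm ?ler0c ?powR_ge0// lecR.
  by apply: ge1r_powR; rewrite ?step_gt0 ?step_le1 ?ltW.
rewrite -modCE lecR (le_trans (hM n (lex1 k) (lex2 k) _ _))//.
- by rewrite /lex1 ltnS/= ltn_divLR.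
- by rewrite /lex2 ltnS/= ltn_mod.
- by rewrite (le_trans (ler_norm _))// lerDl.
Qed.

Lemma opb_potential_small e : 0 < e -> exists N, forall n, (N <= n)%N ->
  [/\ forall k, `|pot_diag n 0 k| <= e%:C, opb (pot_mx n) (e ^+ 2)%:C &
      opb ((pot_mx n)^t*) (e ^+ 2)%:C].
Proof.
move=> e0; have [M M0 hM] := pot_diag_le.
have [N hN] := step_small (divr_gt0 e0 M0); exists N => n /hN hn.
have h k : `|pot_diag n 0 k| <= e%:C.
  by rewrite (le_trans (hM n k))// lecR -ler_pdivlMr.
have h2 k : `|pot_diag n 0 k| ^+ 2 <= (e ^+ 2)%:C.
  by rewrite rmorphXn/= ler_pXn2r ?nnegrE// ler0c ltW.
split => //; rewrite pot_mxE; first exact: opb_diag.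
by rewrite adj_diag_mx; apply: opb_diag => k; rewrite mxE norm_conjC.
Qed.

Lemma pot_mx_bounded : bounded_mx pot_mx.
Proof.
have [M M0 hM] := pot_diag_le; exists (M ^+ 2); first by rewrite exprn_gt0.
move=> n; have h2 k : `|pot_diag n 0 k| ^+ 2 <= (M ^+ 2)%:C.
  rewrite rmorphXn/= ler_pXn2r ?nnegrE ?normr_ge0 ?ler0c ?(ltW M0)//.
  by rewrite (le_trans (hM n k))// lecR ler_piMl ?step_le1// ltW.
rewrite pot_mxE; split; first exact: opb_diag.
by rewrite adj_diag_mx; apply: opb_diag => k; rewrite mxE norm_conjC.
Qed.

Lemma real_t_alpha : realv (t_alpha alpha).
Proof. by have [] := approximable_t_alpha alpha0. Qed.

Lemma perturbed_adj n : (A n)^t* = toeplitz n (t_alpha alpha) + (pot_mx n)^t*.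
Proof.
rewrite /perturbed -/(pot_mx n) adjmxD toeplitz_adj//; last exact: real_t_alpha.
exact: cbmeas_t_alpha.
Qed.

Lemma perturbed_bounded : bounded_mx A.
Proof.
have [c c0 hc] := toeplitz_bounded (cbmeas_t_alpha alpha0) real_t_alpha.
have [d d0 hd] := pot_mx_bounded; exists (2 * (c + d)).
  by rewrite mulr_gt0// addr_gt0.
move=> n; have [h1 h2] := hc n; have [h3 h4] := hd n.
have -> : (2 * (c + d))%:C = 2 * (c%:C + d%:C) :> R[i].
  by rewrite -(rmorph_nat (real_complex R) 2) -rmorphD/= -rmorphM.
split; first exact: opbD h1 h3.
rewrite perturbed_adj; apply: opbD h4.
by rewrite -(toeplitz_adj n (cbmeas_t_alpha alpha0) real_t_alpha).
Qed.

Lemma asymp_perturbed : asymp A (t_alpha alpha).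
Proof.
split; [exact: approximable_t_alpha|exact: perturbed_bounded|].
rewrite (_ : (fun n => _) = pot_mx).
  apply: negl_opb_cvg => e e0.
  have m0 : 0 < Num.min 1 e by rewrite lt_min ltr01.
  have [N hN] := opb_potential_small m0; exists N => n /hN[_ h _].
  apply: opb_le h; rewrite lecR (le_trans (_ : _ <= Num.min 1 e))//.
    by rewrite expr2 ler_piMl ?(ltW m0)// ge_min lexx.
  by rewrite ge_min lexx orbT.
by apply: functional_extensionality_dep => n; rewrite /perturbed addrC addKr.
Qed.

Lemma asymp_perturbed_adj : asymp (fun n => (A n)^t*) (t_alpha alpha).
Proof.
split; first exact: approximable_t_alpha.
  have [c c0 hc] := perturbed_bounded; exists c; first exact: c0.
  move=> n; have [h1 h2] := hc n; split; first exact: h2.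
  by rewrite (trmxCK (A n)); exact: h1.
have [_ _ h] := asymp_perturbed => e /h[N hN]; exists N => n /hN.
rewrite -fro_adj adjmxD adjmxN toeplitz_adj//; last exact: real_t_alpha.
exact: cbmeas_t_alpha.
Qed.

(** The Toeplitz part is self-adjoint, so the skew part of the matrix is
    that of its diagonal term. *)
Lemma perturbed_eigen_Im e : 0 < e -> exists N, forall n, (N <= n)%N ->
  forall z, eigenvalue (A n) z -> `|complex.Im z| <= e.
Proof.
move=> e0; have [N hN] := opb_potential_small e0.
exists N => n /hN[h _ _] z zA.
pose w : 'rV[R[i]]_(n * n) :=
  \row_k ('i * (pot_diag n 0 k - (pot_diag n 0 k)^*)).
have E : 'i *: (A n - (A n)^t*) = diag_mx w.
  rewrite perturbed_adj /perturbed -/(pot_mx n) opprD addrACA subrr add0r.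
  rewrite pot_mxE adj_diag_mx -raddfB/= -linearZ/=; congr diag_mx.
  by apply/rowP => k; rewrite !mxE.
have wb k : - (2 * e%:C) <= w 0 k <= 2 * e%:C.
  rewrite mxE -real_ler_norml; last first.
    apply/CrealP; rewrite rmorphM/= rmorphB/= conjCK conjCi.
    by rewrite mulNr -mulrN opprB.
  rewrite normrM normCi mul1r (le_trans (ler_normB _ _))//.
  by rewrite norm_conjC mulr_natl mulr2n lerD.
have h1 : `|'Im z| *+ 2 <= 2 * e%:C.
  apply: (eigen_Im_le (A := A n)) => //.
    rewrite E -diag_const_mx -raddfB; apply: psd_diag => k.
    by rewrite [w]lock !mxE -lock subr_ge0; case/andP: (wb k).
  rewrite E -diag_const_mx -raddfD; apply: psd_diag => k.
  by rewrite [w]lock !mxE -lock -lerBlDl sub0r; case/andP: (wb k).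
move: h1; rewrite [2 * _]mulr_natl lerMn2r/= -complexIm.
by rewrite normc_def/= expr0n/= addr0 sqrtr_sqr lecR.
Qed.

Lemma asymp_moments (X : forall n : nat, 'M[R[i]]_(n * n)) f k : asymp X f ->
  o_sqr (fun n => \tr (X n ^+ k) - (n * n)%:R * tavg (fun x => f x ^+ k)).
Proof. by move=> /(asymp_pow k) h e e0; exact: asymp_trace. Qed.

Lemma asymp_eigen_bounded (X : forall n : nat, 'M[R[i]]_(n * n)) f :
  asymp X f ->
  exists C, [/\ 0 < C, forall x, `|f x| <= C%:C &
    forall n z, eigenvalue (X n) z -> `|z| <= C%:C].
Proof.
move=> [[bf _ _] [c c0 hc] _]; have [G G0 hG] := cbmeas_bounded bf.
exists (c + 1 + G); split; first by rewrite !addr_gt0.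
  by move=> x; rewrite (le_trans (hG x))// lecR lerDr ltW// addr_gt0.
move=> n z /(eigen_norm_le (hc n).1); rewrite -modCE -rmorphXn/= !lecR => h.
have : 0 <= (modC z - c) ^+ 2 by exact: sqr_ge0.
nra.
Qed.

Lemma leb2_torus_measure :
  (leb2 : {measure set plane -> \bar R}) torus_square = ((2 * pi) ^+ 2)%:E.
Proof. exact: leb2_torus. Qed.

Lemma torus_finite :
  (0 < (leb2 : {measure set plane -> \bar R}) torus_square < +oo)%E.
Proof.
by rewrite leb2_torus_measure ltry lte_fin exprn_gt0// mulr_gt0// pi_gt0.
Qed.

Lemma measurable_torus_t_alpha :
  cmeasurable_fun torus_square (t_alpha alpha : plane -> _).
Proof.
have [[m1 _] [m2 _]] := cbmeas_t_alpha alpha0.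
by split; apply: measurable_funTS.
Qed.

Lemma perturbed_eig_distr : eig_distr leb2 torus_square A (t_alpha alpha).
Proof.
split; [exact: measurable_torus|exact: torus_finite|
  exact: measurable_torus_t_alpha|].
move=> F cF _; rewrite leb2_torus_measure -/(tavg _).
have as_ := asymp_perturbed; have [C [C0 tC zC]] := asymp_eigen_bounded as_.
apply: (eigenvalues_cvg C0) => //.
- exact: approximable_t_alpha.
- by move=> k; exact: asymp_moments.
- exact: perturbed_eigen_Im.
Qed.

Lemma perturbed_sing_distr : sing_distr leb2 torus_square A (t_alpha alpha).
Proof.
split; [exact: measurable_torus|exact: torus_finite|
  exact: measurable_torus_t_alpha|].
move=> F cF _; rewrite leb2_torus_measure -/(tavg _).
have as_ := asympM asymp_perturbed_adj asymp_perturbed.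
have [C [C0 tC zC]] := asymp_eigen_bounded as_.
(* The singular values are the square roots of the eigenvalues of [A^* A]. *)
pose F' (z : R[i]^o) : R[i]^o := F (Num.sqrt (complex.Re z)).
have cF' : continuous F'.
  move=> z.
  have cs : {for z, continuous (fun z : R[i]^o => Num.sqrt (complex.Re z))}.
    exact: (@continuous_comp _ _ _ (fun z : R[i]^o => complex.Re z) Num.sqrt z
      (@continuous_Re R z) (@sqrt_continuous R _)).
  exact: (@continuous_comp _ _ _ _ F z cs (cF _)).
have imz e : 0 < e -> exists N, forall n, (N <= n)%N ->
    forall z, eigenvalue ((A n)^t* *m A n) z -> `|complex.Im z| <= e.
  move=> e0; exists 0%N => n _ z.
  have psd0 : psd (0 : 'M[R[i]]_(n * n)) by move=> v; rewrite mulmx0 mul0mx mxE.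
  move=> /(eigen_Im_le (e := 0)).
  rewrite adjmxM trmxCK subrr scaler0 subr0 addr0 raddf0 => /(_ psd0 psd0).
  rewrite -[X in _ <= X](mul0rn _ 2) lerMn2r/= normr_le0.
  rewrite -complexIm => /eqP/complexI ->.
  by rewrite normr0 ltW.
have [at2 _ _] := as_.
have := eigenvalues_cvg C0 at2 tC (fun k => asymp_moments k as_) zC imz cF'.
have -> : (fun x => F' (t_alpha alpha x * t_alpha alpha x)) =
    fun x => F (modC (t_alpha alpha x)).
  apply/funext => x; rewrite /F'; congr F.
  rewrite /modC ger0_norm ?t_alpha_ge0// -expr2 -rmorphXn/=.
  by rewrite sqrtr_sqr ger0_norm// powR_ge0.
have -> // : (fun n => (n * n)%:R^-1 * \sum_(s <- singular_values (A n)) F s) =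
    (fun n => (n * n)%:R^-1 *
       \sum_(z <- eigenvalues ((A n)^t* *m A n)) F' z) :> (nat -> R[i]).
by apply/funext => n; rewrite /singular_values big_map.
Qed.

End perturbation.

(** * The generalized locally Toeplitz structure *)

Section glt.
Context {R : realType}.
Local Notation plane := (measurableTypeR R * measurableTypeR R)%type.
Variables (alpha : R) (mu : R * R -> R[i]).
Hypothesis alpha1 : 1 < alpha.
Hypothesis hmu : bounded_samples mu.

Let alpha0 : 0 < alpha. Proof. exact: lt_trans alpha1. Qed.

Lemma Ck_cst k (c : R) : Ck k (fun=> c).
Proof.
elim: k c => [|k IH] c /=; first by split => // x; exact: cvg_cst.
have D v : (fun x : R * R => 'D_v (fun=> c) x) = fun=> 0.
  by apply/funext => x; exact: derive_cst.
split; first by move=> x; exact: cvg_cst.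
rewrite !D; split; [| |exact: IH|exact: IH];
  by move=> x; exact: derivable_cst.
Qed.

Lemma smooth_cst1 : smooth_on_unit_square (fun=> 1 : R[i]).
Proof. by exists (fun=> 1), (fun=> 0); split => [k|k|//]; exact: Ck_cst. Qed.

Lemma sampling_mx1 n s : sampling_mx n s (fun=> 1 : R[i]) = 1%:M.
Proof.
rewrite /sampling_mx -diag_const_mx; congr diag_mx.
by apply/rowP => k; rewrite !mxE.
Qed.

(** A singular value [s] of [B] has [s^2] in the spectrum of [B^* B], which
    is bounded by [c^2]. *)
Lemma spectral_norm_le n (B : 'M[R[i]]_n) (c : R) : 0 <= c ->
  opb (B^t*) (c ^+ 2)%:C -> spectral_norm B <= c.
Proof.
move=> c0 hB; rewrite /spectral_norm big_seq; apply: bigmax_le => // s.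
case/mapP => z /eigenvaluesP /eigenvalueP[v vB v0] ->.
have := hB v; rewrite trmxCK mulmxBr mulmxBl mul_mx_scalar vB -!scalemxAl.
rewrite -scalerBl mxE pmulr_lge0 ?row_sqnorm_gt0// subr_ge0 lecE => /andP[_ h].
by rewrite -[c]ger0_norm// -sqrtr_sqr ler_wsqrtr.
Qed.

Lemma perturbed_GLT : GLT (perturbed alpha mu) (fun p => t_alpha alpha p.2).
Proof.
split.
  have [[m1 _] [m2 _]] := cbmeas_t_alpha alpha0.
  split; apply: measurable_funTS.
    exact: (measurableT_comp m1 measurable_snd).
  exact: (measurableT_comp m2 measurable_snd).
have [_ rt ht] := approximable_t_alpha alpha0.
pose eps (m : nat) : R := m.+1%:R^-1.
have eps0 m : 0 < eps m by rewrite invr_gt0 ltr0n.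
have [p hp] := choice (fun m => ht (eps m) (eps0 m)).
exists (fun=> 1%N), (fun _ _ => fun=> 1), (fun m _ => p m); split.
- by move=> m i _; exact: smooth_cst1.
- by move=> m i _; have [] := hp m.
- move=> e e0; apply: cvg_near_cst.
  have [N hN] := step_small e0.
  exists N => // m /= Nm; rewrite (_ : [set x | _] = set0) ?setI0 ?measure0//.
  rewrite -subset0 => -[x th] /=; rewrite big_ord1 mul1r => h.
  have [_ _ /(_ th)] := hp m; rewrite distrC -modCE lecR => h2.
  have := lt_le_trans h (le_trans h2 (hN m Nm)).
  by rewrite ltxx.
- exists (fun=> 0), (fun m => 2 * eps m); split.
  + exact: cvg_cst.
  + rewrite -[X in _ --> X](mulr0 2); apply: cvgM.
      exact: cvg_cst.
    exact: cvg_harmonic.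
  move=> m; have [N hN] := opb_potential_small alpha1 hmu (eps0 m).
  exists N => n /hN[_ h1 h2]; have [tp rp pt] := hp m.
  have bt := cbmeas_t_alpha alpha0; have bp := trig_polynomial_cbmeas tp.
  exists 0, (toeplitz n (fun x => t_alpha alpha x - p m x) + pot_mx alpha mu n).
  have bB := cbmeasB bt bp; have rB := realvB rt rp.
  have hT := @opb_toeplitz R n _ _ bB rB (eps0 m) pt.
  split.
  + rewrite big_ord1 sampling_mx1 mul1mx addr0 toeplitzB// addrA.
    by rewrite [toeplitz n (p m) + _]addrC subrK.
  + by rewrite mxrank0 mul0r.
  apply: spectral_norm_le; first by rewrite mulr_ge0// ltW.
  rewrite adjmxD (toeplitz_adj n bB rB).
  have -> : ((2 * eps m) ^+ 2)%:C =
      2 * ((eps m ^+ 2)%:C + (eps m ^+ 2)%:C) :> R[i].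
    rewrite -rmorphD/= -(rmorph_nat (real_complex R) 2) -rmorphM/=.
    by congr (_%:C); ring.
  exact: opbD hT h2.
Qed.

End glt.

Theorem theorem4 (R : realType) (alpha : R) (mu : R * R -> R[i]%C)
    (halpha : ((1 < alpha) && (alpha < 2))%R)
    (hmu : ess_bounded mu) (hsamples : bounded_samples mu) :
  [/\ GLT (perturbed alpha mu) (fun p => t_alpha alpha p.2),
      sing_distr leb2 torus_square (perturbed alpha mu) (t_alpha alpha) &
      eig_distr leb2 torus_square (perturbed alpha mu) (t_alpha alpha)].
Proof.
have /andP[alpha1 _] := halpha.
split; [exact: perturbed_GLT|exact: perturbed_sing_distr|].
exact: perturbed_eig_distr.
Qed.
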